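(* Assume (A1)–(A3) from the context and assume $L_\Phi<1$, where $L_\Phi=L_F+L_G$. Let $\delta_{\text{up}},\widehat\delta_{\text{low}}\in(0,1)$, and run PATA (described in the context) with $\gamma^k=\min\{1,\frac{1}{2k^{1/2}}\}$ (so $\gamma^0=1$), $\bar\tau^i=\max\{1,i\}$ and $\bar\varepsilon^i=\frac{1}{(\bar\tau^i)^2}$. Define $$I_{\max}=\left\lceil\max\left\{\frac1{\delta_{\text{up}}},\frac{H+1}{\widehat\delta_{\text{low}}}\right\}\right\rceil .$$ For $\eta\in(0,\tfrac12)$ let $$C_1=\Big(D^2+\tfrac54(R+H)^2\Big)^2,\qquad C_{2,\eta}=\left(\frac{(R+H)^2}{4\eta}\right)^{\frac{2}{1-2\eta}},$$ $$\sigma=I_{\max}\left\lceil\max\left\{I_{\max}^8\frac{(D+R)^4}{(1-L_\Phi)^2}C_1,\; I_{\max}^{\frac{8}{1-2\eta}}\frac{(D+R)^{\frac{4}{1-2\eta}}}{(1-L_\Phi)^{\frac{2}{1-2\eta}}}C_{2,\eta}\right\}\right\rceil .$$ Then in at most $\sigma$ iterations $k$ PATA reaches an iteration $k$ at which all of the following hold: (1) the upper-level approximate problem is solved by $x=z^{k+1}$ with some $\varepsilon_{\text{up}}\le\delta_{\text{up}}$, i.e. $G(z^{k+1})^T(y-z^{k+1})\ge-\varepsilon_{\text{up}}$ for all $y\in\mathrm{SOL}(F,Y)$; (2) the lower-level approximate problem is solved by $x=z^{k+1}$ with some $\widehat\varepsilon_{\text{low}}\le\widehat\delta_{\text{low}}$,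 i.e. $V(z^{k+1})\le\widehat\varepsilon_{\text{low}}$; (3) the condition in step (S.4) of PATA is satisfied.
   Context: Let $F,G:\mathbb R^n\to\mathbb R^n$ and $Y\subseteq\mathbb R^n$. $\mathrm{SOL}(F,Y)$ denotes the set of all $x\in Y$ with $F(x)^T(y-x)\ge 0$ for all $y\in Y$. Assumptions: (A1) $G$ is Lipschitz continuous with constant $L_G$ and monotone on $Y$ (i.e. $(G(x)-G(y))^T(x-y)\ge 0$ for all $x,y\in Y$). (A2) $F$ is Lipschitz continuous with constant $L_F$ and monotone on $Y$. (A3) $Y$ is nonempty, convex and compact. For $\tau>0$ let $\Phi_\tau(x)=F(x)+\frac1\tau G(x)$. $P_Y$ is the Euclidean projection onto $Y$. Constants: $H=\max_{y\in Y}\|G(y)\|_2$, $R=\max_{y\in Y}\|F(y)\|_2$, $D=\max_{v,y\in Y}\|v-y\|_2$. Natural residual of the lower level: $V(x)=\|P_Y(x-F(x))-x\|_2$. Projected Averaging Tikhonov Algorithm (PATA). Data: $\{\bar\varepsilon^i\}\subseteq[0,\infty)$, $\{\bar\tau^i\}\subseteq(0,\infty)$, $\gamma^k\in(0,1]$, $w^0=z^0=y^0\in Y$; initialize $i=0$, $l=0$. For $k=0,1,2,\ldots$: (S.1) set $\varepsilon^k=\bar\varepsilon^i$, $\tau^k=\bar\tau^i$; (S.2) set $y^{k+1}=P_Y\big(y^k-\gamma^{k-l}\Phi_{\tau^k}(y^k)\big)$; (S.3) set $z^{k+1}=\big(\sum_{j=l}^{k+1}\gamma^{j-l}y^j\big)/\big(\sum_{j=l}^{k+1}\gamma^{j-l}\big)$;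 (S.4) if $\min_{y\in Y}\Phi_{\tau^k}(z^{k+1})^T(y-z^{k+1})\ge-\varepsilon^k$, then set $w^{i+1}=z^{k+1}$, replace $i$ by $i+1$, and set $l=k+1$. Superscripts on $\gamma,y,z,w,\bar\tau,\bar\varepsilon,\tau,\varepsilon$ are indices, except in $(\bar\tau^i)^2$, where the outer exponent is a power. *)

(* Defs.v *)
From HB Require Import structures.
From mathcomp Require Import all_boot all_order all_algebra.
From mathcomp Require Import all_classical all_reals all_analysis.

Set Implicit Arguments.
Unset Strict Implicit.
Unset Printing Implicit Defensive.

Import Order.TTheory GRing.Theory Num.Theory.

Local Open Scope classical_set_scope.
Local Open Scope ring_scope.

Definition dot (R : realType) (n : nat) (u v : 'cV[R]_n) : R :=
  (u^T *m v) ord0 ord0.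

(* The norm that the library puts on 'cV[R]_n is the sup norm. *)
Definition norm2 (R : realType) (n : nat) (u : 'cV[R]_n) : R :=
  Num.sqrt (dot u u).

(* Attained extrema; 0 when there is none. *)
Definition set_max (R : realType) (A : set R) : R :=
  xget 0 (A `&` ubound A).

Definition set_min (R : realType) (A : set R) : R :=
  xget 0 (A `&` lbound A).

(* Unique when Y is nonempty, closed and convex; 0 if there is no nearest
   point. *)
Definition proj (R : realType) (n : nat) (Y : set 'cV[R]_n) (x : 'cV[R]_n) :
    'cV[R]_n :=
  xget 0 [set p | Y p /\ forall y, Y y -> norm2 (x - p) <= norm2 (x - y)].

(* The explicit 0 <= L matters only when Y has at most one point. *)
Definition lipschitz_on2 (R : realType) (n : nat) (Y : set 'cV[R]_n)
    (L : R) (F : 'cV[R]_n -> 'cV[R]_n) : Prop :=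
  0 <= L /\
  forall x y, Y x -> Y y -> norm2 (F x - F y) <= L * norm2 (x - y).

Definition monotone_on (R : realType) (n : nat) (Y : set 'cV[R]_n)
    (F : 'cV[R]_n -> 'cV[R]_n) : Prop :=
  forall x y, Y x -> Y y -> 0 <= dot (F x - F y) (x - y).

Definition SOL (R : realType) (n : nat) (F : 'cV[R]_n -> 'cV[R]_n)
    (Y : set 'cV[R]_n) : set 'cV[R]_n :=
  [set x | Y x /\ forall y, Y y -> 0 <= dot (F x) (y - x)].

Definition Phi (R : realType) (n : nat) (F G : 'cV[R]_n -> 'cV[R]_n)
    (tau : R) (x : 'cV[R]_n) : 'cV[R]_n :=
  F x + tau^-1 *: G x.

Definition max_norm2 (R : realType) (n : nat) (Y : set 'cV[R]_n)
    (F : 'cV[R]_n -> 'cV[R]_n) : R :=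
  set_max [set norm2 (F y) | y in Y].

Definition diameter (R : realType) (n : nat) (Y : set 'cV[R]_n) : R :=
  set_max [set norm2 (v - y) | v in Y & y in Y].

Definition natural_residual (R : realType) (n : nat)
    (F : 'cV[R]_n -> 'cV[R]_n) (Y : set 'cV[R]_n) (x : 'cV[R]_n) : R :=
  norm2 (proj Y (x - F x) - x).

Definition pata_test (R : realType) (n : nat) (F G : 'cV[R]_n -> 'cV[R]_n)
    (Y : set 'cV[R]_n) (eps tau : R) (z : 'cV[R]_n) : Prop :=
  - eps <= set_min [set dot (Phi F G tau z) (y - z) | y in Y].

(* i k and l k are the values of the counters i and l at the start of
   iteration k, so that tau^k = taub (i k) and eps^k = epsb (i k). *)
Record pata_run (R : realType) (n : nat) (F G : 'cV[R]_n -> 'cV[R]_n)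
    (Y : set 'cV[R]_n) (gamma epsb taub : nat -> R)
    (i l : nat -> nat) (y z w : nat -> 'cV[R]_n) : Prop := PataRun {
  pata_y0 : Y (y 0%N);
  pata_z0 : z 0%N = y 0%N;
  pata_w0 : w 0%N = y 0%N;
  pata_i0 : i 0%N = 0%N;
  pata_l0 : l 0%N = 0%N;
  pata_yS : forall k,
    y k.+1 = proj Y (y k - gamma (k - l k)%N *: Phi F G (taub (i k)) (y k));
  pata_zS : forall k,
    z k.+1 = (\sum_(l k <= j < k.+2) gamma (j - l k)%N)^-1 *:
             \sum_(l k <= j < k.+2) gamma (j - l k)%N *: y j;
  pata_pass : forall k,
    pata_test F G Y (epsb (i k)) (taub (i k)) (z k.+1) ->
    [/\ w (i k).+1 = z k.+1, i k.+1 = (i k).+1 & l k.+1 = k.+1];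
  pata_fail : forall k,
    ~ pata_test F G Y (epsb (i k)) (taub (i k)) (z k.+1) ->
    i k.+1 = i k /\ l k.+1 = l k
}.

(* The case k = 0 is separate because 0^-1 = 0 in the library. *)
Definition gamma_seq (R : realType) (k : nat) : R :=
  if k == 0%N then 1 else Num.min 1 (2 * Num.sqrt k%:R)^-1.

Definition tau_seq (R : realType) (i : nat) : R := Num.max 1 i%:R.

Definition eps_seq (R : realType) (i : nat) : R := (tau_seq R i ^+ 2)^-1.

(* Main.v *)
Require Import Defs.
From HB Require Import structures.
From mathcomp Require Import all_boot all_order all_algebra.
From mathcomp Require Import all_classical all_reals all_analysis.
From mathcomp Require Import ring lra.

Set Implicit Arguments.
Unset Strict Implicit.
Unset Printing Implicit Defensive.

Import Order.TTheory GRing.Theory Num.Theory.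
Import numFieldNormedType.Exports.

Local Open Scope classical_set_scope.
Local Open Scope ring_scope.

(** Why the theorem holds. Within one phase, with [tau] fixed, the averages of a
    projected gradient method for the monotone map [Phi F G tau] satisfy the
    usual regret bound ([minty_gap]): after [N] iterations the gap of the average
    [z], measured with the values of the map at the comparison points, is of
    order [N ^ (eta - 1/2)]. Since the map is Lipschitz with constant [LF + LG < 1],
    the projected residual at [z] is controlled by that bound, and the residual
    controls the gap measured with the value of the map at [z]
    ([gap_le_residual]), which is the quantity tested by the algorithm.

    With [d = D + RF] this gives a gap of at most [eps] as soon as the regret is
    below [eps ^ 2 * (1 - LF - LG) / d ^ 2], but only if [D] is not too small:
    otherwise the constant [d], which does not contain [H], fails to absorb a
    term of second order. When [D] is small, the map hardly varies over [Y],
    and a regret bound without squared steps ([gap_shifted]) takes over; the two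
    regimes meet thanks to the numerical inequality [small_diameter_bound]. The
    outcome is [phase_gap].

    Consequently phase [j] lasts at most [phase_len (T j)] iterations, where
    [T] is the quantity under the ceiling in [sigma], as a function of the
    number of the phase ([iter_bound]). When phase [I] passes its test, the gap
    is at most [I ^ -2] with [tau = I], which yields both levels
    ([upper_gap], [lower_residual]). The phases are numbered from [0], so there
    are [I + 1] of them; the phases [0] and [1] together fit into
    the time of one long phase because [T] grows by a factor of at least [256]
    from [1] to [I] ([phase_len_twice]). This fails only when every phase lasts
    a single iteration. In that case the iteration that ends phase [I - 1] already
    has a gap of at most [I ^ -2], and the residual is at most [D], which is
    then at most [I ^ -1]. *)

(** * Elementary inequalities *)

Lemma le_from_sqr (R : realDomainType) (a b : R) :
  0 <= b -> a ^+ 2 <= b ^+ 2 -> a <= b.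
Proof.
move=> b0; have [a0|a0] := leP a 0; first lra.
by rewrite ler_pXn2r // ?nnegrE ?ltW.
Qed.

(** For [w <= 1 / 3] the part [(P + Q / 2) * w] is of order [Num.sqrt (q * w)],
    and the rest is at most [2 * q * (1 - q)]. For larger [w] the
    Cauchy-Schwarz inequality on the ellipse of the last constraint suffices. *)
Lemma small_diameter_scaled (R : realFieldType) (P Q q w : R) :
  0 <= P -> 0 <= Q -> 0 < q <= 1 -> 0 < w <= 3 / 4 -> Q <= 2 * q ->
  (Q ^+ 2 + 5 / 4 * P ^+ 2) * w <= q ->
  (P + Q / 2) * w + (1 - q) * Q <= 1.
Proof.
move=> P0 Q0 /andP[q0 q1] /andP[w0 w1] Qq PQ.
have [w3|w3] := leP w (1 / 3).
  have h : ((P + Q / 2) * w) ^+ 2 <= 7 / 20 * q.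
    have h1 : (P + Q / 2) ^+ 2 <= 21 / 20 * (Q ^+ 2 + 5 / 4 * P ^+ 2).
      have : 0 <= (5 / 4 * P - 2 * Q) ^+ 2 by exact: sqr_ge0.
      by rewrite !expr2; lra.
    have h2 : (P + Q / 2) ^+ 2 * w <= 21 / 20 * q by nra.
    by rewrite exprMn [w ^+ 2]expr2 mulrA; nra.
  (* The arithmetic-geometric mean inequality, balanced near q = 3 / 5. *)
  have h3 : (P + Q / 2) * w <= 9 / 40 + 7 / 18 * q.
    have : 0 <= ((P + Q / 2) * w - 9 / 20) ^+ 2 by exact: sqr_ge0.
    by rewrite sqrrB; lra.
  have h4 : (1 - q) * Q <= (1 - q) * (2 * q) by apply: ler_wpM2l; lra.
  have : 0 <= (q - 3 / 5) ^+ 2 by exact: sqr_ge0.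
  by rewrite sqrrB; nra.
pose c := w / 2 + 1 - q.
have TE : (P + Q / 2) * w + (1 - q) * Q = c * Q + w * P by rewrite /c; field.
have c0 : 0 <= c by rewrite /c; lra.
rewrite TE; apply: le_from_sqr => //; rewrite expr1n.
have h1 : (c * Q + w * P) ^+ 2 <=
    (c ^+ 2 + 4 / 5 * w ^+ 2) * (Q ^+ 2 + 5 / 4 * P ^+ 2).
  have : 0 <= (5 / 4 * c * P - w * Q) ^+ 2 by exact: sqr_ge0.
  by rewrite !expr2; lra.
have k0 : 0 <= c ^+ 2 + 4 / 5 * w ^+ 2.
  by have := sqr_ge0 c; have := sqr_ge0 w; lra.
have h2 : (c * Q + w * P) ^+ 2 * w <= (c ^+ 2 + 4 / 5 * w ^+ 2) * q.
  apply: le_trans (ler_wpM2r (ltW w0) h1) _.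
  by rewrite -[leLHS]mulrA; exact: ler_wpM2l k0 _ _ PQ.
have h3 : (c ^+ 2 + 4 / 5 * w ^+ 2) * q <= w.
  (* Convexity in w reduces the claim to the ends of the range. *)
  have hw : w ^+ 2 <= 13 / 12 * w - 1 / 4 by nra.
  have -> : (c ^+ 2 + 4 / 5 * w ^+ 2) * q =
    q * (1 - q) ^+ 2 + q * (1 - q) * w + 21 / 20 * q * w ^+ 2.
    by rewrite /c; field.
  have h4 : q * w ^+ 2 <= q * (13 / 12 * w - 1 / 4).
    exact: ler_wpM2l (ltW q0) _ _ hw.
  have e1 : q * (1 - q) ^+ 2 + q * (1 - q) / 3 + 21 / 180 * q <= 1 / 3.
    have : 0 <= q * (q - 1 / 2) ^+ 2 by rewrite mulr_ge0 ?sqr_ge0 ?ltW.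
    have : 0 <= (q - 1 / 2) ^+ 2 by exact: sqr_ge0.
    by rewrite !expr2; nra.
  have e2 : q * (1 - q) ^+ 2 + q * (1 - q) * (3 / 4)
      + 21 / 20 * (9 / 16) * q <= 3 / 4.
    have : 0 <= q * (q - 1 / 2) ^+ 2 by rewrite mulr_ge0 ?sqr_ge0 ?ltW.
    have : 0 <= (q - 1 / 2) ^+ 2 by exact: sqr_ge0.
    by rewrite !expr2; nra.
  have f1 := ler_wpM2r (_ : 0 <= 12 / 5 * (3 / 4 - w)) e1.
  have f2 := ler_wpM2r (_ : 0 <= 12 / 5 * (w - 1 / 3)) e2.
  have {}f1 := f1 ltac:(lra); have {}f2 := f2 ltac:(lra).
  lra.
by rewrite -(ler_pM2r w0) mul1r; lra.
Qed.

(** The scaled inequality with [P = X * D / eps], [Q = D ^+ 2 / eps] and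
    [w = (Num.sqrt N.+1%:R)^-1]; [N] is positive, so [w] is at most
    [1 / Num.sqrt 2], which is below [3 / 4]. *)
Lemma small_diameter_bound (R : realType) (D d X q eps : R) (N : nat) :
  0 <= D <= d -> 0 <= X -> 0 < q <= 1 -> 0 < eps -> (0 < N)%N ->
  D * d <= 2 * q * eps ->
  d ^+ 2 * (D ^+ 2 + 5 / 4 * X ^+ 2) <= eps ^+ 2 * q * Num.sqrt N%:R ->
  (X * D + D ^+ 2 / 2) / Num.sqrt N.+1%:R + (1 - q) * D ^+ 2 <= eps.
Proof.
move=> /andP[D0 Dd] X0 q01 eps0 N0 Ddq bound.
have s_gt0 : 0 < Num.sqrt (N.+1%:R : R) by rewrite sqrtr_gt0.
have sE : Num.sqrt (N.+1%:R : R) ^+ 2 = N.+1%:R by rewrite sqr_sqrtr.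
set s := Num.sqrt N.+1%:R in s_gt0 sE *.
have s43 : 4 / 3 <= s.
  have : (2 : R) <= N.+1%:R by rewrite ler_nat.
  by rewrite -sE expr2; nra.
have Ns : Num.sqrt (N%:R : R) <= s by rewrite ler_sqrt // ler_nat.
have e_neq0 : eps != 0 by rewrite gt_eqF.
have DD : D ^+ 2 <= D * d by rewrite expr2 ler_wpM2l.
have h := @small_diameter_scaled R (X * D / eps) (D ^+ 2 / eps) q s^-1.
have {}h : (X * D / eps + D ^+ 2 / eps / 2) * s^-1 +
    (1 - q) * (D ^+ 2 / eps) <= 1.
  apply: h => //.
  - by rewrite divr_ge0 ?mulr_ge0 // ltW.
  - by rewrite divr_ge0 ?sqr_ge0 // ltW.
  - rewrite invr_gt0 s_gt0 /=.
    by rewrite -[leRHS]invrK lef_pV2 ?posrE ?invr_gt0 //; lra.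
  - by rewrite ler_pdivrMr //; lra.
  rewrite ler_pdivrMr //.
  have -> : (D ^+ 2 / eps) ^+ 2 + 5 / 4 * (X * D / eps) ^+ 2 =
    D ^+ 2 * (D ^+ 2 + 5 / 4 * X ^+ 2) / eps ^+ 2 by field.
  rewrite ler_pdivrMr ?exprn_gt0 //.
  have A0 : 0 <= D ^+ 2 + 5 / 4 * X ^+ 2 by have := sqr_ge0 D; have := sqr_ge0 X; lra.
  have D2 : D ^+ 2 <= d ^+ 2 by rewrite ler_pXn2r ?nnegrE // (le_trans D0).
  apply: le_trans (ler_wpM2r A0 D2) _; apply: le_trans bound _.
  rewrite [leRHS]mulrC mulrA ler_wpM2l // mulr_ge0 ?sqr_ge0 //.
  by case/andP: q01 => /ltW.
have {}h := ler_wpM2r (ltW eps0) h.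
rewrite mul1r in h; apply: le_trans h; rewrite le_eqVlt; apply/orP; left.
by apply/eqP; field; rewrite e_neq0 gt_eqF.
Qed.

(** * Euclidean geometry of column vectors *)

Lemma dotE (R : realType) (n : nat) (u v : 'cV[R]_n) :
  dot u v = \sum_j u j ord0 * v j ord0.
Proof. by rewrite /dot mxE; apply: eq_bigr => j _; rewrite mxE. Qed.

Lemma dotC (R : realType) (n : nat) (u v : 'cV[R]_n) : dot u v = dot v u.
Proof. by rewrite !dotE; apply: eq_bigr => j _; rewrite mulrC. Qed.

Lemma dotDl (R : realType) (n : nat) (u v x : 'cV[R]_n) :
  dot (u + v) x = dot u x + dot v x.
Proof. by rewrite /dot linearD /= mulmxDl mxE. Qed.

Lemma dotDr (R : realType) (n : nat) (u v x : 'cV[R]_n) :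
  dot x (u + v) = dot x u + dot x v.
Proof. by rewrite /dot mulmxDr mxE. Qed.

Lemma dotZl (R : realType) (n : nat) (a : R) (u x : 'cV[R]_n) :
  dot (a *: u) x = a * dot u x.
Proof. by rewrite /dot linearZ /= -scalemxAl mxE. Qed.

Lemma dotZr (R : realType) (n : nat) (a : R) (u x : 'cV[R]_n) :
  dot x (a *: u) = a * dot x u.
Proof. by rewrite dotC dotZl dotC. Qed.

Lemma dotNl (R : realType) (n : nat) (u x : 'cV[R]_n) : dot (- u) x = - dot u x.
Proof. by rewrite -scaleN1r dotZl mulN1r. Qed.

Lemma dotNr (R : realType) (n : nat) (u x : 'cV[R]_n) : dot x (- u) = - dot x u.
Proof. by rewrite dotC dotNl dotC. Qed.

Lemma dot0l (R : realType) (n : nat) (x : 'cV[R]_n) : dot 0 x = 0.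
Proof. by rewrite -(scale0r 0) dotZl mul0r. Qed.

Lemma dot0r (R : realType) (n : nat) (x : 'cV[R]_n) : dot x 0 = 0.
Proof. by rewrite dotC dot0l. Qed.

Lemma dot_sumr (R : realType) (n : nat) (I : Type) (s : seq I)
    (f : I -> 'cV[R]_n) (x : 'cV[R]_n) :
  dot x (\sum_(j <- s) f j) = \sum_(j <- s) dot x (f j).
Proof.
by elim/big_rec2: _ => [|j a b _ <-]; [exact: dot0r | rewrite dotDr].
Qed.

Lemma dot_ge0 (R : realType) (n : nat) (u : 'cV[R]_n) : 0 <= dot u u.
Proof. by rewrite dotE; apply: sumr_ge0 => j _; rewrite -expr2 sqr_ge0. Qed.

Lemma dot_eq0 (R : realType) (n : nat) (u : 'cV[R]_n) : dot u u = 0 -> u = 0.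
Proof.
rewrite dotE => /eqP; rewrite psumr_eq0; last first.
  by move=> j _; rewrite -expr2 sqr_ge0.
move=> /allP u0; apply/colP => j; rewrite mxE; apply/eqP.
by have := u0 j (mem_index_enum _); rewrite mulf_eq0 orbb.
Qed.

Definition dotE_lin := (dotDl, dotDr, dotNl, dotNr, dotZl, dotZr).

Lemma dot_subZ (R : realType) (n : nat) (t : R) (u v : 'cV[R]_n) :
  dot (u - t *: v) (u - t *: v) =
  dot u u - 2 * (t * dot u v) + t * (t * dot v v).
Proof. by rewrite !dotE_lin (dotC v u); ring. Qed.

Lemma norm2_ge0 (R : realType) (n : nat) (u : 'cV[R]_n) : 0 <= norm2 u.
Proof. exact: sqrtr_ge0. Qed.

Lemma norm2_sqr (R : realType) (n : nat) (u : 'cV[R]_n) :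
  norm2 u ^+ 2 = dot u u.
Proof. by rewrite /norm2 sqr_sqrtr ?dot_ge0. Qed.

Lemma norm2_eq0 (R : realType) (n : nat) (u : 'cV[R]_n) : norm2 u = 0 -> u = 0.
Proof. by move=> u0; apply: dot_eq0; rewrite -norm2_sqr u0 expr0n. Qed.

Lemma norm2_0 (R : realType) (n : nat) : norm2 (0 : 'cV[R]_n) = 0.
Proof. by rewrite /norm2 dot0l sqrtr0. Qed.

Lemma norm2N (R : realType) (n : nat) (u : 'cV[R]_n) : norm2 (- u) = norm2 u.
Proof. by rewrite /norm2 dotNl dotNr opprK. Qed.

Lemma norm2_sub (R : realType) (n : nat) (u v : 'cV[R]_n) :
  norm2 (u - v) = norm2 (v - u).
Proof. by rewrite -norm2N opprB. Qed.

Lemma norm2Z (R : realType) (n : nat) (a : R) (u : 'cV[R]_n) :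
  0 <= a -> norm2 (a *: u) = a * norm2 u.
Proof.
move=> a0; rewrite /norm2 dotZl dotZr mulrA -expr2 sqrtrM ?sqr_ge0 //.
by rewrite sqrtr_sqr ger0_norm.
Qed.

(** Cauchy-Schwarz, from the nonnegativity of the square of
    [norm2 v *: u - norm2 u *: v]. *)
Lemma dot_le_norm2 (R : realType) (n : nat) (u v : 'cV[R]_n) :
  dot u v <= norm2 u * norm2 v.
Proof.
have [u0|u0] := eqVneq (norm2 u) 0.
  by rewrite (norm2_eq0 u0) dot0l norm2_0 mul0r.
have [v0|v0] := eqVneq (norm2 v) 0.
  by rewrite (norm2_eq0 v0) dot0r norm2_0 mulr0.
have uv_gt0 : 0 < norm2 u * norm2 v.
  by rewrite mulr_gt0 // lt_def norm2_ge0 ?u0 ?v0.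
have := dot_ge0 (norm2 v *: u - norm2 u *: v).
rewrite !dotE_lin (dotC v u) -!norm2_sqr => h.
have {}h : 0 <= (norm2 u * norm2 v) * (norm2 u * norm2 v - dot u v) by nra.
by rewrite pmulr_rge0 // subr_ge0 in h.
Qed.

Lemma norm2D (R : realType) (n : nat) (u v : 'cV[R]_n) :
  norm2 (u + v) <= norm2 u + norm2 v.
Proof.
rewrite -(@ler_pXn2r _ 2) ?nnegrE ?addr_ge0 ?norm2_ge0 //.
rewrite norm2_sqr !dotE_lin (dotC v u) sqrrD !norm2_sqr.
have := dot_le_norm2 u v; lra.
Qed.

(** * Extrema over a compact set and the metric projection *)

Lemma continuous_sum (R : realType) (T : topologicalType) (I : Type)
    (s : seq I) (f : I -> T -> R) :
  (forall j, continuous (f j)) -> continuous (fun x => \sum_(j <- s) f j x).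
Proof.
move=> cf; elim: s => [|j s IHs] x.
  by under eq_fun do rewrite big_nil; exact: cvg_cst.
under eq_fun do rewrite big_cons.
by apply: cvgD; [exact: cf | exact: IHs].
Qed.

Lemma continuous_dot (R : realType) (n : nat) (T : topologicalType)
    (f g : T -> 'cV[R]_n) :
  (forall j, continuous (fun x => f x j ord0)) ->
  (forall j, continuous (fun x => g x j ord0)) ->
  continuous (fun x => dot (f x) (g x)).
Proof.
move=> cf cg; under eq_fun do rewrite dotE.
by apply: continuous_sum => j x; apply: cvgM; [exact: cf | exact: cg].
Qed.

Lemma continuous_norm2 (R : realType) (n : nat) (T : topologicalType)
    (f : T -> 'cV[R]_n) :
  (forall j, continuous (fun x => f x j ord0)) ->
  continuous (fun x => norm2 (f x)).
Proof.
move=> cf x; have cd := continuous_dot cf cf.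
by apply: (continuous_comp (cd x)); exact: sqrt_continuous.
Qed.

Lemma continuous_subr (R : realType) (T : topologicalType) (f : T -> R) (a : R) :
  continuous f -> continuous (fun x => f x - a).
Proof. by move=> cf x; apply: cvgB; [exact: cf | exact: cvg_cst]. Qed.

Lemma continuous_coordB (R : realType) (n : nat) (a : 'cV[R]_n) (j : 'I_n) :
  continuous (fun x : 'cV[R]_n => (x - a) j ord0).
Proof.
under eq_fun do rewrite !mxE.
exact/continuous_subr/coord_continuous.
Qed.

Lemma continuous_dotB (R : realType) (n : nat) (g a : 'cV[R]_n) :
  continuous (fun x : 'cV[R]_n => dot g (x - a)).
Proof.
apply: continuous_dot => j; last exact: continuous_coordB.
exact: cst_continuous.
Qed.

Lemma continuous_dist2 (R : realType) (n : nat) (a : 'cV[R]_n) :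
  continuous (fun x : 'cV[R]_n => norm2 (x - a)).
Proof. by apply: continuous_norm2; exact: continuous_coordB. Qed.

(** The Lipschitz property is stated for the Euclidean norm, whereas the topology
    comes from the sup norm; continuity of [norm2] links the two. *)
Lemma continuous_norm2_lipschitz (R : realType) (n : nat) (Y : set 'cV[R]_n)
    (L : R) (F : 'cV[R]_n -> 'cV[R]_n) :
  lipschitz_on2 Y L F -> {within Y, continuous (fun y => norm2 (F y))}.
Proof.
move=> [L0 FL]; apply/subspace_continuousP => x Yx.
apply/cvgrPdist_lt => e e0.
have L1_gt0 : 0 < L + 1 by lra.
have := @continuous_dist2 R n x x.
rewrite /continuous_at subrr norm2_0 => /cvgrPdist_lt /(_ (e / (L + 1))).
rewrite divr_gt0 // => /(_ isT).
rewrite /within /= !near_simpl /=; apply: filterS => y /=.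
rewrite sub0r normrN ger0_norm ?norm2_ge0 // ltr_pdivlMr // norm2_sub => xy Yy.
suff : `|norm2 (F x) - norm2 (F y)| <= L * norm2 (x - y).
  by have := norm2_ge0 (x - y); lra.
apply: le_trans (FL _ _ Yx Yy).
rewrite ler_norml; apply/andP; split.
  have := norm2D (F y - F x) (F x); rewrite subrK norm2_sub; lra.
have := norm2D (F x - F y) (F y); rewrite subrK; lra.
Qed.

Lemma set_maxP (R : realType) (T : topologicalType) (A : set T) (f : T -> R) :
  A !=set0 -> compact A -> {within A, continuous f} ->
  forall a, A a -> f a <= set_max [set f x | x in A].
Proof.
move=> A0 cA cf a Aa; have [c cinA fc] := compact_EVT_max A0 cA cf.
rewrite inE in cinA; rewrite /set_max; case: xgetP => [y _ [_ /(_ (f a))]|/(_ (f c))].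
  by apply; exists a.
by case; split=> [|_ [b Ab <-]]; [exists c | apply: fc; rewrite inE].
Qed.

(** Compactness rules out the default value [0] of [set_min]. *)
Lemma le_set_min (R : realType) (T : topologicalType) (A : set T) (f : T -> R)
    (e : R) :
  A !=set0 -> compact A -> {within A, continuous f} ->
  e <= set_min [set f x | x in A] <-> forall a, A a -> e <= f a.
Proof.
move=> A0 cA cf; have [c cinA fc] := compact_EVT_min A0 cA cf.
rewrite inE in cinA; rewrite /set_min; case: xgetP; last first.
  move=> /(_ (f c)); case; split=> [|_ [b Ab <-]]; first by exists c.
  by apply: fc; rewrite inE.
move=> y _ [[b Ab <-] /= hb]; split=> [eb a Aa|]; last exact.
by apply: le_trans eb (hb _ _); exists a.
Qed.

Lemma convex_setP (R : realType) (n : nat) (Y : set 'cV[R]_n) :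
  convex_set Y -> forall (t : R) u v, 0 <= t <= 1 -> Y u -> Y v ->
  Y (t *: u + (1 - t) *: v).
Proof.
move=> cY t u v t01 Yu Yv.
case/andP: t01 => t0 t1.
have := cY u v (Itv01 t0 t1); rewrite !inE; exact.
Qed.

(** Existence is compactness; the variational inequality expresses that moving
    from the projection towards [y] does not decrease the distance to [x], to
    first order. *)
Lemma projP (R : realType) (n : nat) (Y : set 'cV[R]_n) (x : 'cV[R]_n) :
  Y !=set0 -> convex_set Y -> compact Y ->
  Y (Defs.proj Y x) /\
  forall y, Y y -> dot (x - Defs.proj Y x) (y - Defs.proj Y x) <= 0.
Proof.
move=> Y0 convY cY; rewrite /Defs.proj; case: xgetP; last first.
  have cf : {within Y, continuous (fun y => norm2 (x - y))}.
    under eq_fun do rewrite norm2_sub.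
    exact/continuous_subspaceT/continuous_dist2.
  have [c cinY fc] := compact_EVT_min Y0 cY cf.
  move=> /(_ c); case; rewrite inE in cinY; split=> // y Yy.
  by apply: fc; rewrite inE.
move=> p _ [Yp minp]; split=> // y Yy; rewrite leNgt; apply/negP => c_gt0.
set v := y - p in c_gt0; set u := x - p in c_gt0; set c := dot u v in c_gt0.
set b := dot v v.
have b_ge0 : 0 <= b := dot_ge0 _.
(* Any positive t <= 1 with t * b < 2 * c would do; this choice avoids a
   case distinction on b. *)
pose t := c / (c + b).
have cb_gt0 : 0 < c + b by lra.
have t01 : 0 <= t <= 1.
  apply/andP; split; first exact: divr_ge0 (ltW _) (ltW _).
  by rewrite ler_pdivrMr // mul1r; lra.
have tE : t * (c + b) = c by rewrite /t divfK ?gt_eqF.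
have t_gt0 : 0 < t by rewrite /t divr_gt0.
have := minp _ (convex_setP convY t01 Yy Yp).
rewrite -(@ler_pXn2r _ 2) ?nnegrE ?norm2_ge0 // !norm2_sqr.
have -> : x - (t *: y + (1 - t) *: p) = u - t *: v.
  by apply/colP => j; rewrite !mxE; ring.
rewrite dot_subZ -/b -/c => h.
have {}h : 0 <= t * (t * b - 2 * c) by lra.
rewrite pmulr_rge0 // in h; have tc_gt0 : 0 < t * c := mulr_gt0 t_gt0 c_gt0.
lra.
Qed.

(** * The step sizes *)

Lemma gamma_seqS (R : realType) (m : nat) :
  gamma_seq R m.+1 = (2 * Num.sqrt m.+1%:R)^-1.
Proof.
have s1 : 1 <= Num.sqrt (m.+1%:R : R).
  by rewrite -[leLHS]sqrtr1 ler_sqrt // ler1n.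
rewrite /gamma_seq /= min_r // invf_le1; lra.
Qed.

Lemma gamma_seq_gt0 (R : realType) (m : nat) : 0 < gamma_seq R m.
Proof.
case: m => [|m]; first by rewrite /gamma_seq eqxx.
by rewrite gamma_seqS invr_gt0 mulr_gt0 // sqrtr_gt0.
Qed.

(** The increment [1 / (2 * Num.sqrt N)] of the sum exceeds the increment of the
    square root. *)
Lemma sum_gamma_seq_ge (R : realType) (N : nat) :
  Num.sqrt N.+1%:R <= \sum_(m < N.+1) gamma_seq R m.
Proof.
elim: N => [|N IHN]; first by rewrite big_ord1 sqrtr1.
rewrite big_ord_recr /= gamma_seqS; apply: (le_trans _ (lerD IHN (lexx _))).
have s_gt0 : 0 < Num.sqrt (N.+1%:R : R) by rewrite sqrtr_gt0.
have sE : Num.sqrt (N.+1%:R : R) ^+ 2 = N.+1%:R by rewrite sqr_sqrtr.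
apply: le_from_sqr; first by rewrite addr_ge0 ?invr_ge0 ?mulr_ge0 // ltW.
rewrite sqr_sqrtr //; set s := Num.sqrt _ in s_gt0 sE *.
have -> : (s + (2 * s)^-1) ^+ 2 = s ^+ 2 + 1 + (2 * s)^-1 ^+ 2.
  by field; rewrite gt_eqF.
by rewrite sE -natr1 lerDl sqr_ge0.
Qed.

(** After the first one, the squared steps are a quarter of the harmonic series,
    so their sum is logarithmic; the power of [N] comes from [ln x < x] at [x = N `^ eta]. *)
Lemma sum_gamma_seq_sqr_le (R : realType) (N : nat) (eta : R) :
  (0 < N)%N -> 0 < eta ->
  \sum_(m < N.+1) gamma_seq R m ^+ 2 <= 5 / 4 + N%:R `^ eta / (4 * eta).
Proof.
case: N => // N _ eta_gt0.
have logb : \sum_(m < N.+2) gamma_seq R m ^+ 2 <= 5 / 4 + ln N.+1%:R / 4.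
  elim: N => [|N IHN].
    rewrite big_ord_recr big_ord1 /= gamma_seqS sqrtr1 ln1 /gamma_seq eqxx.
    by rewrite expr1n mulr1 expr2; lra.
  rewrite big_ord_recr /= gamma_seqS; apply: (le_trans (lerD IHN (lexx _))).
  rewrite exprVn exprMn sqr_sqrtr //.
  set x : R := N.+1%:R; have x_gt0 : 0 < x by rewrite ltr0n.
  have -> : N.+2%:R = x + 1 :> R by rewrite -natr1.
  have y_gt0 : 0 < x + 1 by lra.
  have : ln (1 + (- (x + 1)^-1)) <= - (x + 1)^-1.
    by apply: le_ln1Dx; rewrite ltrN2 invf_lt1 //; lra.
  have -> : 1 - (x + 1)^-1 = x / (x + 1) by field; lra.
  rewrite ln_div ?posrE // => h.
  have -> : (2 ^+ 2 * (x + 1))^-1 = (x + 1)^-1 / 4 by field; lra.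
  lra.
apply: le_trans logb _; rewrite lerD2l invfM mulrA mulrAC ler_pM2r //.
rewrite ler_pdivlMr // mulrC -ln_powR.
apply: ltW (ln_sublinear _); exact: powR_gt0.
Qed.

(** The ratios of consecutive steps are 1/2, sqrt (1/2), sqrt (2/3), ... *)
Lemma gamma_seq_ratio_mono (R : realType) (m : nat) :
  gamma_seq R m.+1 / gamma_seq R m <= gamma_seq R m.+2 / gamma_seq R m.+1.
Proof.
rewrite ler_pdivrMr ?gamma_seq_gt0 // mulrAC ler_pdivlMr ?gamma_seq_gt0 //.
rewrite -expr2 !gamma_seqS exprVn exprMn sqr_sqrtr //.
have s_gt0 : 0 < Num.sqrt (m.+2%:R : R) by rewrite sqrtr_gt0.
have sE : Num.sqrt (m.+2%:R : R) ^+ 2 = m.+2%:R by rewrite sqr_sqrtr.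
case: m s_gt0 sE => [|m] s_gt0 sE.
  rewrite /gamma_seq eqxx mulr1 mulr1 lef_pV2 ?posrE ?mulr_gt0 //.
  by move: sE; rewrite expr2; nra.
have t_gt0 : 0 < Num.sqrt (m.+1%:R : R) by rewrite sqrtr_gt0.
have tE : Num.sqrt (m.+1%:R : R) ^+ 2 = m.+1%:R by rewrite sqr_sqrtr.
rewrite gamma_seqS -invfM lef_pV2 ?posrE ?mulr_gt0 //.
set s := Num.sqrt _ in s_gt0 sE *; set t := Num.sqrt _ in t_gt0 tE *.
have -> : 2 * s * (2 * t) = 2 ^+ 2 * (s * t) by ring.
rewrite ler_pM2l // -natr1 -[m.+2%:R]natr1 -tE in sE *.
have : 0 <= (s - t) ^+ 2 by exact: sqr_ge0.
by rewrite sqrrB; lra.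
Qed.

Lemma gamma_seq_ratio_le1 (R : realType) (m : nat) :
  gamma_seq R m.+1 / gamma_seq R m <= 1.
Proof.
rewrite ler_pdivrMr ?gamma_seq_gt0 // mul1r gamma_seqS.
have s1 : 1 <= Num.sqrt (m.+1%:R : R).
  by rewrite -[leLHS]sqrtr1 ler_sqrt // ler1n.
case: m s1 => [|m] s1; first by rewrite /gamma_seq eqxx invf_le1; lra.
rewrite gamma_seqS lef_pV2 ?posrE ?mulr_gt0 ?sqrtr_gt0 //.
by rewrite ler_pM2l // ler_sqrt // ler_nat.
Qed.

(** * One phase of projected averaging *)

Fixpoint proj_grad (R : realType) (n : nat) (Y : set 'cV[R]_n)
    (g : 'cV[R]_n -> 'cV[R]_n) (gamma : nat -> R) (u0 : 'cV[R]_n) (m : nat) :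
    'cV[R]_n :=
  if m is p.+1 then
    let u := proj_grad Y g gamma u0 p in Defs.proj Y (u - gamma p *: g u)
  else u0.

Definition weighted_avg (R : realType) (n : nat) (gamma : nat -> R)
    (u : nat -> 'cV[R]_n) (N : nat) : 'cV[R]_n :=
  (\sum_(m < N.+1) gamma m)^-1 *: \sum_(m < N.+1) gamma m *: u m.

Lemma proj_grad_in (R : realType) (n : nat) (Y : set 'cV[R]_n)
    (g : 'cV[R]_n -> 'cV[R]_n) (gamma : nat -> R) (u0 : 'cV[R]_n) (m : nat) :
  convex_set Y -> compact Y -> Y u0 -> Y (proj_grad Y g gamma u0 m).
Proof.
move=> convY cY Yu0; case: m => [|m] //=.
by apply: (projP _ _ convY cY).1; exists u0.
Qed.

Lemma sum_gt0 (R : realType) (gamma : nat -> R) (N : nat) :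
  (forall m, 0 < gamma m) -> 0 < \sum_(m < N.+1) gamma m.
Proof.
move=> g0; rewrite big_ord_recr /= ltr_wpDl //.
by apply: sumr_ge0 => m _; exact: ltW.
Qed.

Lemma weighted_avg_in (R : realType) (n : nat) (Y : set 'cV[R]_n)
    (gamma : nat -> R) (u : nat -> 'cV[R]_n) (N : nat) :
  convex_set Y -> (forall m, 0 < gamma m) -> (forall m, Y (u m)) ->
  Y (weighted_avg gamma u N).
Proof.
move=> convY g0 Yu; elim: N => [|N IHN].
  by rewrite /weighted_avg !big_ord1 scalerA mulVf ?gt_eqF // scale1r.
move: IHN (sum_gt0 N g0); rewrite /weighted_avg !(big_ord_recr N.+1) /=.
set S := \sum_(m < N.+1) _; set V := \sum_(m < N.+1) _ => YV S0.
have c0 := g0 N.+1; set c := gamma N.+1 in c0 *.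
have t01 : 0 <= S / (S + c) <= 1.
  apply/andP; split; first by rewrite divr_ge0 // ltW // addr_gt0.
  by rewrite ler_pdivrMr ?addr_gt0 // mul1r lerDl ltW.
have := convex_setP convY t01 YV (Yu N.+1).
suff -> : S / (S + c) *: (S^-1 *: V) + (1 - S / (S + c)) *: u N.+1 =
    (S + c)^-1 *: (V + c *: u N.+1) by [].
have Sc0 : S + c != 0 by rewrite gt_eqF // addr_gt0.
rewrite scalerDr !scalerA; congr (_ *: _ + _ *: _); last by field.
by field; rewrite Sc0 gt_eqF.
Qed.

Lemma dot_weighted_avg (R : realType) (n : nat) (gamma : nat -> R)
    (u : nat -> 'cV[R]_n) (N : nat) (x v : 'cV[R]_n) :
  (forall m, 0 < gamma m) ->
  (\sum_(m < N.+1) gamma m) * dot x (weighted_avg gamma u N - v) =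
  \sum_(m < N.+1) gamma m * dot x (u m - v).
Proof.
move=> g0; have S0 := sum_gt0 N g0.
rewrite dotDr dotNr /weighted_avg dotZr mulrBr mulrA divff ?gt_eqF // mul1r.
rewrite dot_sumr mulr_suml -sumrB; apply: eq_bigr => m _.
by rewrite dotZr dotDr dotNr mulrBr.
Qed.

Lemma sum_telescope_le (R : realType) (a e b : nat -> R) (N : nat) :
  (forall m, a m <= e m - e m.+1 + b m) ->
  \sum_(m < N.+1) a m <= e 0%N - e N.+1 + \sum_(m < N.+1) b m.
Proof.
move=> ae; elim: N => [|N IHN]; first by rewrite !big_ord1.
by rewrite 2!(big_ord_recr N.+1) /=; have := ae N.+1; lra.
Qed.

(** Summation by parts: the weights [r] increase and [E - e] is nonnegative, so
    the last weight dominates. *)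
Lemma sum_weighted_telescope_le (R : realType) (a e r b : nat -> R) (E : R)
    (N : nat) :
  (forall m, 0 <= r m) -> (forall m, r m <= r m.+1) -> (forall m, e m <= E) ->
  (forall m, a m <= r m * (e m - e m.+1) + b m) ->
  \sum_(m < N.+1) a m <= r N * (E - e N.+1) + \sum_(m < N.+1) b m.
Proof.
move=> r0 rS eE ae; elim: N => [|N IHN].
  rewrite !big_ord1; apply: le_trans (ae 0%N) _; rewrite lerD2r.
  by apply: ler_wpM2l; rewrite // lerD2r.
rewrite 2!(big_ord_recr N.+1) /=.
have : r N * (E - e N.+1) <= r N.+1 * (E - e N.+1).
  by apply: ler_wpM2r; rewrite // subr_ge0.
have := ae N.+1; lra.
Qed.

Lemma norm2_sqrB (R : realType) (n : nat) (a b : 'cV[R]_n) :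
  norm2 (a - b) ^+ 2 = dot a a - 2 * dot a b + dot b b.
Proof. by rewrite norm2_sqr !dotE_lin (dotC b a); ring. Qed.

(** The variational inequality of the projection, expressed with the squared
    distances to the comparison point, so that it telescopes. *)
Lemma proj_step (R : realType) (n : nat) (Y : set 'cV[R]_n) (c : R)
    (u x v : 'cV[R]_n) :
  convex_set Y -> compact Y -> Y v ->
  let u' := Defs.proj Y (u - c *: x) in
  2 * (c * dot x (u' - v)) <=
  norm2 (u - v) ^+ 2 - norm2 (u' - v) ^+ 2 - norm2 (u - u') ^+ 2.
Proof.
move=> convY cY Yv /=.
have := (projP (u - c *: x) (ex_intro _ v Yv) convY cY).2 v Yv.
move: (Defs.proj Y _) => u'.
by rewrite !norm2_sqrB !dotE_lin ?(dotC v u'); lra.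
Qed.

(** The bound for the usual subgradient method; the last term pays for
    evaluating the map before the step. *)
Lemma proj_step_before (R : realType) (n : nat) (Y : set 'cV[R]_n) (c X : R)
    (u x v : 'cV[R]_n) :
  convex_set Y -> compact Y -> Y v -> norm2 x <= X ->
  let u' := Defs.proj Y (u - c *: x) in
  2 * (c * dot x (u - v)) <=
  norm2 (u - v) ^+ 2 - norm2 (u' - v) ^+ 2 + c ^+ 2 * X ^+ 2.
Proof.
move=> convY cY Yv xX /=; have := proj_step c u x convY cY Yv => /=.
move: (Defs.proj Y _) => u'.
have : 0 <= dot ((u - u') - c *: x) ((u - u') - c *: x) by exact: dot_ge0.
have : c ^+ 2 * norm2 x ^+ 2 <= c ^+ 2 * X ^+ 2.
  rewrite ler_wpM2l ?sqr_ge0 // ler_pXn2r ?nnegrE ?norm2_ge0 //.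
  exact: le_trans (norm2_ge0 _) xX.
rewrite dot_subZ -norm2_sqr -norm2_sqr (dotC (u - u') x) expr2.
have -> : dot x (u - v) = dot x (u - u') + dot x (u' - v).
  by rewrite -dotDr addrA subrK.
lra.
Qed.

(** Sum of [proj_step_before] over the phase; monotonicity replaces the values of
    the map at the iterates by the value at [v], which is common to all
    terms and can be taken out of the average. *)
Lemma minty_gap (R : realType) (n : nat) (Y : set 'cV[R]_n)
    (g : 'cV[R]_n -> 'cV[R]_n) (gamma : nat -> R) (D X : R) (u0 : 'cV[R]_n)
    (N : nat) (v : 'cV[R]_n) :
  convex_set Y -> compact Y -> monotone_on Y g ->
  (forall m, 0 < gamma m) ->
  (forall x y, Y x -> Y y -> norm2 (x - y) <= D) ->
  (forall x, Y x -> norm2 (g x) <= X) -> Y u0 -> Y v ->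
  2 * (\sum_(m < N.+1) gamma m) *
    dot (g v) (weighted_avg gamma (proj_grad Y g gamma u0) N - v) <=
  D ^+ 2 + X ^+ 2 * \sum_(m < N.+1) gamma m ^+ 2.
Proof.
move=> convY cY mono g0 hD hX Yu0 Yv.
rewrite -mulrA dot_weighted_avg //; set u := proj_grad Y g gamma u0.
have Yu m : Y (u m) by exact: proj_grad_in.
have step m : 2 * (gamma m * dot (g v) (u m - v)) <=
    norm2 (u m - v) ^+ 2 - norm2 (u m.+1 - v) ^+ 2 + X ^+ 2 * gamma m ^+ 2.
  have h1 := proj_step_before (gamma m) (u m) convY cY Yv (hX _ (Yu m)).
  have h2 : gamma m * dot (g v) (u m - v) <= gamma m * dot (g (u m)) (u m - v).
    apply: ler_wpM2l; first exact: ltW.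
    by have := mono _ _ (Yu m) Yv; rewrite dotDl dotNl; lra.
  rewrite [X ^+ 2 * _]mulrC; apply: le_trans h1; lra.
have := sum_telescope_le N step.
rewrite -mulr_sumr -mulr_sumr => h; apply: le_trans h _; rewrite lerD2r.
apply: (@le_trans _ _ (norm2 (u 0%N - v) ^+ 2)).
  by rewrite gerBl sqr_ge0.
rewrite ler_pXn2r ?nnegrE ?norm2_ge0 ?hD //.
exact: le_trans (norm2_ge0 _) (hD _ _ Yu0 Yv).
Qed.

(** Pairing each value of the map with the next iterate makes the term in the
    squared steps disappear; the price is the variation of the map over [Y],
    which is small when [Y] is. The ratios of consecutive steps increase, so
    the weighted sum of the differences of squared distances still
    telescopes. *)
Lemma gap_shifted (R : realType) (n : nat) (Y : set 'cV[R]_n)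
    (g : 'cV[R]_n -> 'cV[R]_n) (gamma : nat -> R) (D X L : R) (u0 : 'cV[R]_n)
    (N : nat) (v : 'cV[R]_n) :
  convex_set Y -> compact Y -> lipschitz_on2 Y L g ->
  (forall m, 0 < gamma m) -> gamma 0%N = 1 ->
  (forall m, gamma m.+1 / gamma m <= 1) ->
  (forall m, gamma m.+1 / gamma m <= gamma m.+2 / gamma m.+1) ->
  (forall x y, Y x -> Y y -> norm2 (x - y) <= D) ->
  (forall x, Y x -> norm2 (g x) <= X) -> Y u0 -> Y v ->
  let z := weighted_avg gamma (proj_grad Y g gamma u0) N in
  (\sum_(m < N.+1) gamma m) * dot (g z) (z - v) <=
  X * D + D ^+ 2 / 2 + (\sum_(m < N.+1) gamma m) * (L * D ^+ 2).
Proof.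
move=> convY cY [L0 lip] g0 g01 ratio1 ratioS hD hX Yu0 Yv /=.
set z := weighted_avg _ _ _.
rewrite dot_weighted_avg //; set u := proj_grad Y g gamma u0.
have Yu m : Y (u m) by exact: proj_grad_in.
have Yz : Y z by exact: (weighted_avg_in N convY g0 Yu).
have D0 : 0 <= D := le_trans (norm2_ge0 _) (hD _ _ Yz Yv).
have X0 : 0 <= X := le_trans (norm2_ge0 _) (hX _ Yz).
pose e m := norm2 (u m - v) ^+ 2.
have e0 m : 0 <= e m by exact: sqr_ge0.
have eD m : e m <= D ^+ 2 by rewrite ler_pXn2r ?nnegrE ?norm2_ge0 ?hD.
have first_term : dot (g z) (u 0%N - v) <= X * D.
  apply: le_trans (dot_le_norm2 _ _) _.
  by apply: ler_pM; rewrite ?norm2_ge0 ?hX ?hD.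
pose r m := gamma m.+1 / gamma m.
have r0 m : 0 < r m by rewrite divr_gt0.
have step m : gamma m.+1 * dot (g z) (u m.+1 - v) <=
    r m * (e m / 2 - e m.+1 / 2) + gamma m.+1 * (L * D ^+ 2).
  have h1 : dot (g z - g (u m)) (u m.+1 - v) <= L * D ^+ 2.
    apply: le_trans (dot_le_norm2 _ _) _.
    rewrite expr2 mulrA; apply: ler_pM; rewrite ?norm2_ge0 ?hD //.
    by apply: le_trans (lip _ _ Yz (Yu m)) _; rewrite ler_wpM2l ?hD.
  have h2 : gamma m * dot (g (u m)) (u m.+1 - v) <= (e m - e m.+1) / 2.
    have := proj_step (gamma m) (u m) (g (u m)) convY cY Yv.
    have := sqr_ge0 (norm2 (u m - u m.+1)); rewrite /e /=; lra.
  have -> : dot (g z) (u m.+1 - v) =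
      dot (g z - g (u m)) (u m.+1 - v) + dot (g (u m)) (u m.+1 - v).
    by rewrite -dotDl subrK.
  rewrite mulrDr addrC; apply: lerD; last exact: ler_wpM2l (ltW (g0 _)) _ _ h1.
  have -> : gamma m.+1 = r m * gamma m by rewrite /r divfK ?gt_eqF.
  by rewrite -mulrA -mulrBl; exact: ler_wpM2l (ltW (r0 _)) _ _ h2.
move: (g z) first_term step => x first_term step.
have tail : \sum_(m < N) gamma m.+1 * dot x (u m.+1 - v) <=
    D ^+ 2 / 2 + (\sum_(m < N) gamma m.+1) * (L * D ^+ 2).
  case: N {z Yz} (@sum_weighted_telescope_le _
    (fun m => gamma m.+1 * dot x (u m.+1 - v)) (fun m => e m / 2) r
    (fun m => gamma m.+1 * (L * D ^+ 2)) (D ^+ 2 / 2)) => [|N] abel.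
    by rewrite !big_ord0 mul0r addr0 divr_ge0 // sqr_ge0.
  apply: le_trans (abel N _ _ _ _) _ => [m|m|m|m|].
  - exact: ltW.
  - exact: ratioS.
  - by rewrite ler_pM2r ?invr_gt0.
  - exact: step.
  rewrite mulr_suml lerD2r -mulrBl.
  have : r N * ((D ^+ 2 - e N.+1) / 2) <= 1 * ((D ^+ 2 - e N.+1) / 2).
    by apply: ler_wpM2r; rewrite ?ratio1 // divr_ge0 // subr_ge0.
  move=> h; apply: le_trans h _; rewrite mul1r ler_pM2r ?invr_gt0 //.
  by rewrite gerBl.
have sumE (f : nat -> R) : \sum_(m < N.+1) f m = f 0%N + \sum_(m < N) f m.+1.
  by rewrite big_ord_recl; congr (_ + _); apply: eq_bigr.
rewrite (sumE gamma) (sumE (fun m => gamma m * dot x (u m - v))) g01 mul1r.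
have := mulr_ge0 L0 (sqr_ge0 D); lra.
Qed.

(** With [p] the projected point, the projection gives
    [r ^+ 2 <= dot (g z) (z - p)], and replacing [g z] by [g p], where [b] is
    available, costs [L * r ^+ 2]. The second estimate keeps the term
    [(1 - L) * r ^+ 2], which partly compensates [b]. *)
Lemma gap_le_residual (R : realType) (n : nat) (Y : set 'cV[R]_n)
    (g : 'cV[R]_n -> 'cV[R]_n) (L D b : R) (z : 'cV[R]_n) :
  convex_set Y -> compact Y -> lipschitz_on2 Y L g -> Y z ->
  (forall x y, Y x -> Y y -> norm2 (x - y) <= D) ->
  (forall v, Y v -> dot (g v) (z - v) <= b) ->
  let r := norm2 (z - Defs.proj Y (z - g z)) in
  (1 - L) * r ^+ 2 <= b /\
  forall y, Y y -> dot (g z) (z - y) <= D * r + b - (1 - L) * r ^+ 2.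
Proof.
move=> convY cY [L0 lip] Yz hD hb /=.
have [Yp vi] := projP (z - g z) (ex_intro _ z Yz) convY cY.
move: (Defs.proj Y _) Yp vi => p Yp vi.
set r := norm2 (z - p).
have rE : r ^+ 2 = dot (z - p) (z - p) by exact: norm2_sqr.
have to_p : dot (g z) (z - p) <= b + L * r ^+ 2.
  have -> : dot (g z) (z - p) = dot (g p) (z - p) + dot (g z - g p) (z - p).
    by rewrite -dotDl [g p + _]addrC subrK.
  apply: lerD; first exact: hb.
  apply: le_trans (dot_le_norm2 _ _) _; rewrite expr2 mulrA.
  by apply: ler_wpM2r; [exact: norm2_ge0 | exact: lip].
have viE y : Y y -> dot (z - p) (y - p) <= dot (g z) (y - p).
  move=> /vi; have -> : z - g z - p = (z - p) - g z by rewrite addrAC.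
  by rewrite dotDl dotNl; lra.
split; first by have := viE z Yz; rewrite -rE; lra.
move=> y Yy; have := viE y Yy.
have -> : y - p = (y - z) + (z - p) by rewrite addrA subrK.
rewrite (dotDr (y - z) (z - p) (z - p)) (dotDr (y - z) (z - p) (g z)) -rE.
have : dot (z - p) (z - y) <= r * D.
  apply: le_trans (dot_le_norm2 _ _) _.
  by apply: ler_wpM2l; [exact: norm2_ge0 | exact: hD].
rewrite -(opprB y z) !dotNr; lra.
Qed.

(** If the diameter is not too small, the regret bound on the averaged iterate
    and [gap_le_residual] give a gap of at most [D * eps / d]. Otherwise that
    estimate has an uncompensated additive term, and [gap_shifted] is used
    instead. *)
Lemma phase_gap (R : realType) (n : nat) (Y : set 'cV[R]_n)
    (g : 'cV[R]_n -> 'cV[R]_n) (L D X d eps eta : R) (u0 : 'cV[R]_n)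
    (N : nat) :
  convex_set Y -> compact Y -> monotone_on Y g -> lipschitz_on2 Y L g ->
  L < 1 ->
  (forall x y, Y x -> Y y -> norm2 (x - y) <= D) ->
  (forall x, Y x -> norm2 (g x) <= X) -> Y u0 ->
  D <= d -> 0 < d -> 0 < eps -> 0 < eta -> (0 < N)%N ->
  d ^+ 2 * (D ^+ 2 + 5 / 4 * X ^+ 2) <= eps ^+ 2 * (1 - L) * Num.sqrt N%:R ->
  d ^+ 2 * (X ^+ 2 / (4 * eta)) * N%:R `^ eta <=
    eps ^+ 2 * (1 - L) * Num.sqrt N%:R ->
  let z := weighted_avg (gamma_seq R) (proj_grad Y g (gamma_seq R) u0) N in
  forall y, Y y -> dot (g z) (z - y) <= eps.
Proof.
move=> convY cY mono lip L1 hD hX Yu0 Dd d0 eps0 eta0 N0 h1 h2 /=.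
have g0 := @gamma_seq_gt0 R.
have Yz : Y (weighted_avg (gamma_seq R) (proj_grad Y g (gamma_seq R) u0) N).
  by apply: (weighted_avg_in N convY g0) => m; exact: proj_grad_in.
have [L0 _] := lip.
have D0 : 0 <= D := le_trans (norm2_ge0 _) (hD _ _ Yu0 Yu0).
have X0 : 0 <= X := le_trans (norm2_ge0 _) (hX _ Yu0).
have shifted y Yy := gap_shifted N convY cY lip g0 (erefl _)
  (@gamma_seq_ratio_le1 R) (@gamma_seq_ratio_mono R) hD hX Yu0 (Yy : Y y).
have minty v Yv := minty_gap N convY cY mono g0 hD hX Yu0 (Yv : Y v).
have GN := sum_gamma_seq_ge R N; have G2 := sum_gamma_seq_sqr_le N0 eta0.
have G0 := sum_gt0 N g0.
move: (weighted_avg _ _ _) Yz shifted minty => z Yz shifted minty y Yy.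
move: (\sum_(m < N.+1) gamma_seq R m) GN G0 shifted minty =>
  Gam GN G0 shifted minty.
move: (\sum_(m < N.+1) gamma_seq R m ^+ 2) G2 minty => Gam2 G2 minty.
have sN0 : 0 < Num.sqrt (N.+1%:R : R) by rewrite sqrtr_gt0.
have q0 : 0 < 1 - L by lra.
have [small|big] := ltP (D * d) (2 * (1 - L) * eps).
  have q1 : 1 - L <= 1 by lra.
  have := @small_diameter_bound R D d X (1 - L) eps N.
  rewrite D0 Dd X0 q0 q1 eps0 N0 (ltW small) h1.
  move=> /(_ isT isT isT isT isT isT isT); apply: le_trans.
  have -> : 1 - (1 - L) = L by ring.
  rewrite -(ler_pM2l G0); apply: le_trans (shifted y Yy) _.
  rewrite mulrDr lerD2r mulrCA ler_peMr ?ler_pdivlMr ?mul1r //.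
  by rewrite addr_ge0 ?divr_ge0 ?mulr_ge0 ?sqr_ge0.
pose s := eps / d; have s0 : 0 < s by rewrite divr_gt0.
have sd : s * d = eps by rewrite divfK ?gt_eqF.
have sN : Num.sqrt (N%:R : R) <= Gam.
  by apply: le_trans GN; rewrite ler_sqrt // ler_nat.
have hb v : Y v -> dot (g v) (z - v) <= (1 - L) * s ^+ 2.
  move=> Yv; have dG0 : 0 < d ^+ 2 * (2 * Gam).
    by rewrite mulr_gt0 ?exprn_gt0 ?mulr_gt0.
  rewrite -(ler_pM2l dG0) -mulrA.
  have -> : d ^+ 2 * (2 * Gam) * ((1 - L) * s ^+ 2) =
    2 * (eps ^+ 2 * (1 - L) * Gam) by rewrite -sd; ring.
  have m1 := ler_wpM2l (sqr_ge0 d) (minty v Yv).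
  have m2 : X ^+ 2 * Gam2 <= X ^+ 2 * (5 / 4 + N%:R `^ eta / (4 * eta)).
    by rewrite ler_wpM2l ?sqr_ge0.
  have {}m2 := ler_wpM2l (sqr_ge0 d) m2.
  have m3 : d ^+ 2 * (X ^+ 2 * (5 / 4 + N%:R `^ eta / (4 * eta))) =
    d ^+ 2 * (5 / 4 * X ^+ 2) + d ^+ 2 * (X ^+ 2 / (4 * eta)) * N%:R `^ eta.
    by field; rewrite gt_eqF.
  have m4 : eps ^+ 2 * (1 - L) * Num.sqrt N%:R <= eps ^+ 2 * (1 - L) * Gam.
    by rewrite ler_wpM2l // mulr_ge0 ?sqr_ge0 // ltW.
  rewrite m3 in m2; move: m1 m2 h1 h2 m4; rewrite !mulrDr.
  move: (d ^+ 2 * (X ^+ 2 * Gam2)) (Num.sqrt _) (powR _ _) => *; lra.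
have [rb gapz] := gap_le_residual convY cY lip Yz hD hb.
move: (norm2 _) (norm2_ge0 (z - Defs.proj Y (z - g z))) rb gapz => r r0 rb gapz.
apply: le_trans (gapz y Yy) _.
have rs : r <= s.
  by apply: le_from_sqr (ltW s0) _; rewrite -(ler_pM2l q0).
have Ds : 2 * (1 - L) * s <= D by rewrite -(ler_pM2r d0) -[leLHS]mulrA sd.
have Dse : D * s <= eps by rewrite -sd mulrC ler_wpM2l // ltW.
have : 0 <= (s - r) * (D - (1 - L) * (s + r)).
  by apply: mulr_ge0; nra.
by rewrite !expr2; lra.
Qed.

(** * The regularized map *)

Lemma le_diameter (R : realType) (n : nat) (Y : set 'cV[R]_n) (x y : 'cV[R]_n) :
  compact Y -> Y x -> Y y -> norm2 (x - y) <= diameter Y.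
Proof.
move=> cY Yx Yy.
have cd : continuous (fun p : 'cV[R]_n * 'cV[R]_n => norm2 (p.1 - p.2)).
  apply: continuous_norm2 => j; under eq_fun do rewrite !mxE.
  move=> p; apply: cvgB.
    by apply: (@continuous_comp _ _ _ fst (fun M : 'cV[R]_n => M j ord0));
      [exact: cvg_fst | exact: coord_continuous].
  by apply: (@continuous_comp _ _ _ snd (fun M : 'cV[R]_n => M j ord0));
    [exact: cvg_snd | exact: coord_continuous].
have -> : diameter Y =
    set_max [set norm2 (p.1 - p.2) | p in Y `*` Y].
  congr (set_max _); apply/seteqP; split=> [_ [a Ya [b Yb <-]]|_ [[a b] [Ya Yb] <-]].
    by exists (a, b).
  by exists a => //; exists b.
have YY0 : Y `*` Y !=set0 by exists (x, y).
have := set_maxP YY0 (compact_setX cY cY) (continuous_subspaceT cd).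
by move=> /(_ (x, y)); apply.
Qed.

Lemma le_max_norm2 (R : realType) (n : nat) (Y : set 'cV[R]_n) (L : R)
    (F : 'cV[R]_n -> 'cV[R]_n) (x : 'cV[R]_n) :
  compact Y -> lipschitz_on2 Y L F -> Y x -> norm2 (F x) <= max_norm2 Y F.
Proof.
move=> cY lip Yx.
exact: (set_maxP (ex_intro _ x Yx) cY (continuous_norm2_lipschitz lip) Yx).
Qed.

Lemma Phi_monotone (R : realType) (n : nat) (Y : set 'cV[R]_n)
    (F G : 'cV[R]_n -> 'cV[R]_n) (tau : R) :
  0 < tau -> monotone_on Y F -> monotone_on Y G ->
  monotone_on Y (Phi F G tau).
Proof.
move=> tau0 mF mG x y Yx Yy; rewrite /Phi.
have -> : F x + tau^-1 *: G x - (F y + tau^-1 *: G y) =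
    (F x - F y) + tau^-1 *: (G x - G y).
  by rewrite scalerBr opprD addrACA.
by rewrite dotDl dotZl addr_ge0 ?mF // mulr_ge0 ?invr_ge0 ?mG // ltW.
Qed.

Lemma Phi_lipschitz (R : realType) (n : nat) (Y : set 'cV[R]_n)
    (F G : 'cV[R]_n -> 'cV[R]_n) (LF LG tau : R) :
  1 <= tau -> lipschitz_on2 Y LF F -> lipschitz_on2 Y LG G ->
  lipschitz_on2 Y (LF + LG) (Phi F G tau).
Proof.
move=> tau1 [LF0 lF] [LG0 lG]; split=> [|x y Yx Yy]; first exact: addr_ge0.
have tau0 : 0 < tau by lra.
have -> : Phi F G tau x - Phi F G tau y = (F x - F y) + tau^-1 *: (G x - G y).
  by rewrite /Phi scalerBr opprD addrACA.
apply: le_trans (norm2D _ _) _.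
rewrite norm2Z; last by rewrite invr_ge0 ltW.
rewrite mulrDl; apply: lerD; first exact: lF.
apply: le_trans (lG _ _ Yx Yy).
by rewrite ler_piMl ?norm2_ge0 // invf_le1.
Qed.

Lemma Phi_norm2_le (R : realType) (n : nat) (Y : set 'cV[R]_n)
    (F G : 'cV[R]_n -> 'cV[R]_n) (LF LG tau : R) (x : 'cV[R]_n) :
  1 <= tau -> compact Y -> lipschitz_on2 Y LF F -> lipschitz_on2 Y LG G ->
  Y x -> norm2 (Phi F G tau x) <= max_norm2 Y F + max_norm2 Y G.
Proof.
move=> tau1 cY lF lG Yx; have tau0 : 0 < tau by lra.
apply: le_trans (norm2D _ _) _.
rewrite norm2Z; last by rewrite invr_ge0 ltW.
apply: lerD; first exact: le_max_norm2 lF Yx.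
apply: le_trans (le_max_norm2 cY lG Yx).
by rewrite ler_piMl ?norm2_ge0 // invf_le1.
Qed.

Lemma pata_testP (R : realType) (n : nat) (F G : 'cV[R]_n -> 'cV[R]_n)
    (Y : set 'cV[R]_n) (eps tau : R) (z : 'cV[R]_n) :
  Y !=set0 -> compact Y ->
  pata_test F G Y eps tau z <->
  forall y, Y y -> dot (Phi F G tau z) (z - y) <= eps.
Proof.
move=> Y0 cY; rewrite /pata_test le_set_min //; last first.
  exact/continuous_subspaceT/continuous_dotB.
by split=> h y Yy; have := h y Yy; rewrite -(opprB z y) dotNr lerN2.
Qed.

(** On the lower-level solutions, monotonicity removes the contribution of [F]
    to the gap; only that of [tau^-1 *: G] is left. *)
Lemma upper_gap (R : realType) (n : nat) (F G : 'cV[R]_n -> 'cV[R]_n)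
    (Y : set 'cV[R]_n) (eps tau : R) (z x : 'cV[R]_n) :
  0 < tau -> monotone_on Y F -> Y z ->
  (forall y, Y y -> dot (Phi F G tau z) (z - y) <= eps) ->
  SOL F Y x -> - (tau * eps) <= dot (G z) (x - z).
Proof.
move=> tau0 mF Yz gapz [Yx solx].
have := gapz x Yx; rewrite dotDl dotZl => h.
have h1 := solx z Yz; have := mF z x Yz Yx; rewrite dotDl dotNl => h2.
have {h1 h2}h : tau^-1 * dot (G z) (z - x) <= eps by lra.
rewrite -(opprB z x) dotNr lerN2.
by rewrite mulrC ler_pdivrMr // mulrC in h.
Qed.

Lemma residual_le_diameter (R : realType) (n : nat)
    (F : 'cV[R]_n -> 'cV[R]_n) (Y : set 'cV[R]_n) (z : 'cV[R]_n) :
  convex_set Y -> compact Y -> Y z -> natural_residual F Y z <= diameter Y.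
Proof.
move=> convY cY Yz; apply: le_diameter => //.
by apply: (projP _ _ convY cY).1; exists z.
Qed.

(** The residual [V] satisfies [V ^+ 2 <= tau ^- 2 + (H / tau) * V], from the
    gap at the projected point and the variational inequality there. *)
Lemma lower_residual (R : realType) (n : nat) (F G : 'cV[R]_n -> 'cV[R]_n)
    (Y : set 'cV[R]_n) (LG tau : R) (z : 'cV[R]_n) :
  convex_set Y -> compact Y -> lipschitz_on2 Y LG G -> 0 < tau -> Y z ->
  (forall y, Y y -> dot (Phi F G tau z) (z - y) <= (tau ^+ 2)^-1) ->
  natural_residual F Y z <= (max_norm2 Y G + 1) / tau.
Proof.
move=> convY cY lG tau0 Yz gapz; rewrite /natural_residual.
have GH := le_max_norm2 cY lG Yz.
have [Yp vi] := projP (z - F z) (ex_intro _ z Yz) convY cY.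
move: (Defs.proj Y _) Yp vi => p Yp vi; rewrite norm2_sub.
have := vi z Yz; have -> : z - F z - p = (z - p) - F z by rewrite addrAC.
rewrite dotDl dotNl -norm2_sqr => h1.
have := gapz p Yp; rewrite dotDl dotZl => h2.
have h3 : - (tau^-1 * dot (G z) (z - p)) <= tau^-1 * (max_norm2 Y G * norm2 (z - p)).
  rewrite -mulrN; apply: ler_wpM2l; first by rewrite invr_ge0 ltW.
  rewrite -dotNl; apply: le_trans (dot_le_norm2 _ _) _; rewrite norm2N.
  exact: ler_wpM2r (norm2_ge0 _) _ _ GH.
have H0 : 0 <= max_norm2 Y G := le_trans (norm2_ge0 _) GH.
move: (norm2 _) (norm2_ge0 (z - p)) h1 h3 => V V0 h1 h3.
move: (max_norm2 Y G) H0 h3 => H H0 h3.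
rewrite leNgt; apply/negP; rewrite ltr_pdivrMr // => h4.
have {h1 h2 h3}h : V ^+ 2 <= (tau ^+ 2)^-1 + tau^-1 * (H * V) by lra.
have {}h : (V * tau) ^+ 2 <= 1 + H * (V * tau).
  have := ler_wpM2r (sqr_ge0 tau) h.
  suff -> : ((tau ^+ 2)^-1 + tau^-1 * (H * V)) * tau ^+ 2 = 1 + H * (V * tau).
    by rewrite exprMn.
  by field; rewrite gt_eqF.
by move: (V * tau) h4 h => W h4; rewrite expr2; nra.
Qed.

(** * Runs of the algorithm *)

Lemma pata_y_in (R : realType) (n : nat) (F G : 'cV[R]_n -> 'cV[R]_n)
    (Y : set 'cV[R]_n) (gamma epsb taub : nat -> R) (i l : nat -> nat)
    (y z w : nat -> 'cV[R]_n) (k : nat) :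
  convex_set Y -> compact Y -> pata_run F G Y gamma epsb taub i l y z w ->
  Y (y k).
Proof.
move=> convY cY run; have Yy0 := pata_y0 run; case: k => [|k] //.
by rewrite (pata_yS run); apply: (projP _ _ convY cY).1; exists (y 0%N).
Qed.

(** The average after [m.+1] iterations also contains the initial point of the
    phase, so that it involves [m.+2] points. *)
Lemma phase_average (R : realType) (n : nat) (F G : 'cV[R]_n -> 'cV[R]_n)
    (Y : set 'cV[R]_n) (gamma epsb taub : nat -> R) (i l : nat -> nat)
    (y z w : nat -> 'cV[R]_n) (j k0 m : nat) :
  pata_run F G Y gamma epsb taub i l y z w ->
  (forall p, (p <= m)%N -> i (k0 + p)%N = j /\ l (k0 + p)%N = k0) ->
  z (k0 + m).+1 =
  weighted_avg gamma (proj_grad Y (Phi F G (taub j)) gamma (y k0)) m.+1.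
Proof.
move=> run il; rewrite (pata_zS run) (il m (leqnn m)).2.
have yE p : (p <= m.+1)%N ->
    y (k0 + p)%N = proj_grad Y (Phi F G (taub j)) gamma (y k0) p.
  elim: p => [|p IHp] pm; first by rewrite addn0.
  have [ip lp] := il p pm.
  by rewrite addnS (pata_yS run) ip lp addKn /= -IHp // ltnW.
have reindex (V : nmodType) (f : nat -> V) :
    \sum_(k0 <= q < (k0 + m).+2) f q = \sum_(p < m.+2) f (k0 + p)%N.
  rewrite -{1}[k0]add0n big_addn -!addnS addKn big_mkord.
  by apply: eq_bigr => p _; rewrite addnC.
rewrite /weighted_avg !reindex; congr (_^-1 *: _).
  by apply: eq_bigr => p _; rewrite addKn.
by apply: eq_bigr => p _; rewrite addKn yE // -ltnS.
Qed.

(** A phase that starts at iteration [k0] ends no later than when the average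
    over [N] iterations is bound to pass the test. *)
Lemma phase_ends (R : realType) (n : nat) (F G : 'cV[R]_n -> 'cV[R]_n)
    (Y : set 'cV[R]_n) (gamma epsb taub : nat -> R) (i l : nat -> nat)
    (y z w : nat -> 'cV[R]_n) (j k0 N : nat) :
  pata_run F G Y gamma epsb taub i l y z w ->
  i k0 = j -> l k0 = k0 -> (0 < N)%N ->
  pata_test F G Y (epsb j) (taub j)
    (weighted_avg gamma (proj_grad Y (Phi F G (taub j)) gamma (y k0)) N) ->
  exists m, [/\ (m < N)%N, i (k0 + m)%N = j,
    z (k0 + m).+1 =
      weighted_avg gamma (proj_grad Y (Phi F G (taub j)) gamma (y k0)) m.+1
    & pata_test F G Y (epsb j) (taub j) (z (k0 + m).+1)].
Proof.
move=> run ik0 lk0 N0 testN; apply: contrapT => noend.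
have stay m : (m < N)%N ->
    forall p, (p <= m)%N -> i (k0 + p)%N = j /\ l (k0 + p)%N = k0.
  elim: m => [|m IHm] mN p.
    by rewrite leqn0 => /eqP ->; rewrite addn0.
  have {}IHm := IHm (ltnW mN); rewrite leq_eqVlt => /orP[/eqP ->|]; last exact: IHm.
  have [im lm] := IHm m (leqnn m).
  have : ~ pata_test F G Y (epsb (i (k0 + m)%N)) (taub (i (k0 + m)%N))
      (z (k0 + m).+1).
    rewrite im => test; apply: noend; exists m; split=> //; first exact: ltnW.
    exact: phase_average run IHm.
  by move=> /(pata_fail run); rewrite im lm addnS.
case: N N0 testN noend stay => // N _ testN noend stay.
have av := phase_average run (stay N (leqnn _)).
apply: noend; exists N; split=> //; first exact: (stay N _ N _).1.
by rewrite av.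
Qed.

(** Induction over the phases; the point at which a phase starts is not known in
    advance, so the hypothesis on [len] covers all starting points of the run. *)
Lemma phase_reached (R : realType) (n : nat) (F G : 'cV[R]_n -> 'cV[R]_n)
    (Y : set 'cV[R]_n) (gamma epsb taub : nat -> R) (i l : nat -> nat)
    (y z w : nat -> 'cV[R]_n) (len : nat -> nat) (j : nat) :
  pata_run F G Y gamma epsb taub i l y z w ->
  (forall p k, (p < j)%N -> (0 < len p)%N /\
     pata_test F G Y (epsb p) (taub p)
       (weighted_avg gamma (proj_grad Y (Phi F G (taub p)) gamma (y k)) (len p))) ->
  exists k0, [/\ (k0 <= \sum_(p < j) len p)%N, i k0 = j & l k0 = k0].
Proof.
move=> run; elim: j => [|j IHj] h.
  by exists 0%N; rewrite (pata_i0 run) (pata_l0 run).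
have [p k pj|k0 [k0le ik0 lk0]] := IHj; first by apply: h; rewrite ltnS ltnW.
have [len0 test] := h j k0 (ltnSn j).
have [m [mlen im _ testm]] := phase_ends run ik0 lk0 len0 test.
rewrite -{1 2}im in testm; have [_ iS lS] := pata_pass run testm.
exists (k0 + m).+1; split=> //; last by rewrite iS im.
by rewrite big_ord_recr /= -addnS leq_add.
Qed.

(** * Lengths of the phases *)

(** A number of iterations after which the average is sure to have a gap of at
    most [x ^- 2]; here [c] stands for [(D + RF) ^+ 2 / (1 - LPhi)], and [a] and [b]
    for the coefficients of [1] and [N ^ eta] in the regret. *)
Definition iter_bound (R : realType) (c a b theta x : R) : R :=
  Num.max ((x ^+ 4 * c * a) ^+ 2) ((x ^+ 4 * c * b) `^ theta).

Lemma iter_bound_mono (R : realType) (c a b theta x y : R) :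
  0 <= c -> 0 <= a -> 0 <= b -> 0 <= theta -> 0 <= x <= y ->
  iter_bound c a b theta x <= iter_bound c a b theta y.
Proof.
move=> c0 a0 b0 t0 /andP[x0 xy]; have y0 := le_trans x0 xy.
have x4 : x ^+ 4 * c <= y ^+ 4 * c.
  by apply: ler_wpM2r; rewrite // ler_pXn2r.
have x40 : 0 <= x ^+ 4 * c by rewrite mulr_ge0 ?exprn_ge0.
have y40 : 0 <= y ^+ 4 * c by rewrite mulr_ge0 ?exprn_ge0.
rewrite /iter_bound ge_max !le_max; apply/andP; split; apply/orP; [left|right].
  by rewrite ler_pXn2r ?nnegrE ?mulr_ge0 //; exact: ler_wpM2r a0 _ _ x4.
by apply: ge0_ler_powR; rewrite ?nnegrE ?mulr_ge0 //; exact: ler_wpM2r b0 _ _ x4.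
Qed.

Lemma iter_bound_growth (R : realType) (c a b theta x : R) :
  0 <= c -> 0 <= a -> 0 <= b -> 2 <= theta -> 2 <= x ->
  256 * iter_bound c a b theta 1 <= iter_bound c a b theta x.
Proof.
move=> c0 a0 b0 t2 x2.
have x4 : 16 <= x ^+ 4.
  have -> : 16 = 2 ^+ 4 :> R by rewrite -natrX.
  by rewrite ler_pXn2r ?nnegrE //; lra.
rewrite /iter_bound expr1n mul1r maxr_pMr // ge_max !le_max.
rewrite -(mulrA (x ^+ 4) c a) -(mulrA (x ^+ 4) c b).
apply/andP; split; apply/orP; [left|right].
  rewrite [leRHS]exprMn; apply: ler_wpM2r; first exact: sqr_ge0.
  have -> : 256 = 16 ^+ 2 :> R by rewrite -natrX.
  by rewrite ler_pXn2r ?nnegrE //; lra.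
rewrite [leRHS]powRM; [|lra|exact: mulr_ge0].
apply: ler_wpM2r; first exact: powR_ge0.
have -> : 256 = 16 `^ 2%:R :> R by rewrite powR_mulrn // -natrX.
apply: (@le_trans _ _ (16 `^ theta)); first by apply: ler_powR; lra.
by apply: ge0_ler_powR; rewrite ?nnegrE //; lra.
Qed.

Lemma iter_boundP (R : realType) (c a b eta x : R) (N : nat) :
  0 <= c -> 0 <= a -> 0 <= b -> 0 < eta < 2^-1 -> 0 < x -> (0 < N)%N ->
  iter_bound c a b (2 / (1 - 2 * eta)) x <= N%:R ->
  x ^+ 4 * c * a <= Num.sqrt N%:R /\
  x ^+ 4 * c * b * N%:R `^ eta <= Num.sqrt N%:R.
Proof.
move=> c0 a0 b0 /andP[eta0 eta2] x0 N0.
have x40 : 0 <= x ^+ 4 * c by rewrite mulr_ge0 ?exprn_ge0 // ltW.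
have p0 : 0 < 1 - 2 * eta by lra.
have NR : 0 < N%:R :> R by rewrite ltr0n.
rewrite /iter_bound ge_max => /andP[h1 h2]; split.
  by apply: le_from_sqr; rewrite ?sqrtr_ge0 // sqr_sqrtr // ltW.
have xb0 : 0 <= x ^+ 4 * c * b by rewrite mulr_ge0.
have h3 : x ^+ 4 * c * b <= N%:R `^ ((1 - 2 * eta) / 2).
  have p2 : 0 <= (1 - 2 * eta) / 2 by lra.
  have := @ge0_ler_powR _ _ p2 _ _ (powR_ge0 _ _) (ler0n _ _) h2.
  rewrite -powRrM.
  have -> : 2 / (1 - 2 * eta) * ((1 - 2 * eta) / 2) = 1 by field; lra.
  by rewrite powRr1.
have -> : Num.sqrt N%:R = N%:R `^ ((1 - 2 * eta) / 2) * N%:R `^ eta :> R.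
  rewrite -powR12_sqrt ?ltW // -powRD; last by rewrite (gt_eqF NR) implybT.
  by congr (_ `^ _); field.
by apply: ler_wpM2r h3; exact: powR_ge0.
Qed.

(** The form in which the powers are expanded, as in the bound [sigma]. *)
Lemma iter_boundE (R : realType) (d q a b theta x : R) :
  0 <= x -> 0 <= d -> 0 < q -> 0 <= b ->
  Num.max (x ^+ 8 * (d ^+ 4 / q ^+ 2) * a ^+ 2)
    (x `^ (4 * theta) * (d `^ (2 * theta) / q `^ theta) * b `^ theta) =
  iter_bound (d ^+ 2 / q) a b theta x.
Proof.
move=> x0 d0 q0 b0; rewrite /iter_bound; congr Num.max.
  by field; rewrite gt_eqF.
have c0 : 0 <= d ^+ 2 / q by rewrite divr_ge0 ?sqr_ge0 // ltW.
have q1 : 0 <= q^-1 by rewrite invr_ge0 ltW.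
rewrite (powRM _ (mulr_ge0 (exprn_ge0 4 x0) c0) b0).
rewrite (powRM _ (exprn_ge0 4 x0) c0) (powRM _ (sqr_ge0 d) q1).
rewrite !powRrM !powR_mulrn // -(powR_inv1 (ltW q0)) -powRrM mulN1r powRN.
by [].
Qed.

(** At least [1], since a phase contains at least one iteration. *)
Definition phase_len (R : realType) (t : R) : nat := maxn 1 `|Num.ceil t|%N.

Lemma phase_lenP (R : realType) (t : R) : t <= (phase_len t)%:R.
Proof.
apply: le_trans (ceil_ge t) _.
apply: (@le_trans _ _ (`|Num.ceil t|%N%:R)).
  by rewrite -[leRHS]mulrz_nat natz ler_int lez_abs.
by rewrite ler_nat leq_maxr.
Qed.

Lemma phase_len_le (R : realType) (t : R) (S : nat) :
  0 <= t -> (0 < S)%N -> t <= S%:R -> (phase_len t <= S)%N.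
Proof.
move=> t0 S0 tS; rewrite /phase_len geq_max S0 /=.
have : Num.ceil t <= S%:Z by rewrite ceil_le_int.
by rewrite -lez_nat gez0_abs // ceil_ge0; lra.
Qed.

(** The first two phases have the same parameters, so that [I + 1] phases have
    to fit into the time of [I] long ones; the growth of the bound makes
    room. *)
Lemma phase_len_twice (R : realType) (t T : R) (S : nat) :
  0 <= t -> 256 * t <= T -> T <= S%:R -> (1 < S)%N ->
  (phase_len t + phase_len t <= S)%N.
Proof.
move=> t0 tT TS S1; have [t1|t1] := leP t 1.
  by apply: leq_trans S1; apply: (leq_add (m1 := _) (n1 := 1) (m2 := _) (n2 := 1));
    apply: phase_len_le.
have -> : phase_len t = `|Num.ceil t|%N.
  apply/maxn_idPr; rewrite -ltz_nat gez0_abs ?ceil_ge0; last lra.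
  by rewrite lt_neqAle eq_sym ceil_neq0 ceil_ge0; lra.
rewrite -(ler_nat R) natrD.
have : `|Num.ceil t|%N%:R < t + 1.
  rewrite -[ltLHS]mulrz_nat natz gez0_abs ?ceil_ge0; last lra.
  by have /andP[] := ceil_itv t; rewrite intrD; lra.
lra.
Qed.

Lemma tau_seqS (R : realType) (j : nat) : tau_seq R j.+1 = j.+1%:R.
Proof. by rewrite /tau_seq max_r // ler1n. Qed.

Lemma tau_seq0 (R : realType) : tau_seq R 0 = 1.
Proof. by rewrite /tau_seq max_l. Qed.

Lemma tau_seq_ge1 (R : realType) (j : nat) : 1 <= tau_seq R j.
Proof. by rewrite /tau_seq le_max lexx. Qed.

Theorem theorem2 (R : realType) (n : nat) (F G : 'cV[R]_n -> 'cV[R]_n)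
    (Y : set 'cV[R]_n) (LF LG : R)
    (G_lipschitz : lipschitz_on2 Y LG G) (G_monotone : monotone_on Y G)
    (F_lipschitz : lipschitz_on2 Y LF F) (F_monotone : monotone_on Y F)
    (Y_nonempty : Y !=set0) (Y_convex : convex_set Y) (Y_compact : compact Y)
    (LPhi_lt1 : LF + LG < 1)
    (delta_up delta_low : R)
    (delta_up01 : 0 < delta_up < 1) (delta_low01 : 0 < delta_low < 1)
    (i l : nat -> nat) (y z w : nat -> 'cV[R]_n)
    (run : pata_run F G Y (@gamma_seq R) (@eps_seq R) (@tau_seq R) i l y z w)
    (eta : R) (eta_range : 0 < eta < 2^-1) :
  let LPhi := LF + LG in
  let H := max_norm2 Y G in
  let RF := max_norm2 Y F in
  let D := diameter Y in
  let Imax : int := Num.ceil (Num.max (1 / delta_up) ((H + 1) / delta_low)) in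
  let I : R := Imax%:~R in
  let C1 := (D ^+ 2 + 5 / 4 * (RF + H) ^+ 2) ^+ 2 in
  let C2 := ((RF + H) ^+ 2 / (4 * eta)) `^ (2 / (1 - 2 * eta)) in
  let sigma : int := Imax * Num.ceil (Num.max
    (I ^+ 8 * ((D + RF) ^+ 4 / (1 - LPhi) ^+ 2) * C1)
    (I `^ (8 / (1 - 2 * eta)) *
     ((D + RF) `^ (4 / (1 - 2 * eta)) / (1 - LPhi) `^ (2 / (1 - 2 * eta))) *
     C2)) in
  exists k : nat, k%:Z < Num.max 1 sigma /\
    [/\ (exists2 eps_up : R, eps_up <= delta_up &
           forall x, SOL F Y x -> - eps_up <= dot (G (z k.+1)) (x - z k.+1)),
        (exists2 eps_low : R, eps_low <= delta_low &
           natural_residual F Y (z k.+1) <= eps_low)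
      & pata_test F G Y (eps_seq R (i k)) (tau_seq R (i k)) (z k.+1)].
Proof.
move=> LPhi H RF D Imax I C1 C2 sigma.
have /andP[up0 up1] := delta_up01; have /andP[low0 low1] := delta_low01.
have /andP[eta0 eta2] := eta_range.
have g0 := @gamma_seq_gt0 R.
have Yy k : Y (y k) := pata_y_in k Y_convex Y_compact run.
have hD u v : Y u -> Y v -> norm2 (u - v) <= D := le_diameter Y_compact.
have hH u : Y u -> norm2 (G u) <= H := le_max_norm2 Y_compact G_lipschitz.
have hRF u : Y u -> norm2 (F u) <= RF := le_max_norm2 Y_compact F_lipschitz.
have [[LF0 _] [LG0 _]] := (F_lipschitz, G_lipschitz).
have D0 : 0 <= D := le_trans (norm2_ge0 _) (hD _ _ (Yy 0%N) (Yy 0%N)).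
have H0 : 0 <= H := le_trans (norm2_ge0 _) (hH _ (Yy 0%N)).
have RF0 : 0 <= RF := le_trans (norm2_ge0 _) (hRF _ (Yy 0%N)).
have Yavg u0 tau N : Y u0 -> Y (weighted_avg (gamma_seq R)
    (proj_grad Y (Phi F G tau) (gamma_seq R) u0) N).
  move=> Yu0; apply: (weighted_avg_in N Y_convex g0) => m.
  exact: proj_grad_in.
have testP eps tau u := pata_testP F G eps tau u Y_nonempty Y_compact.
(* If [Y] is a single point, the first iteration has all the properties. *)
have [D_le0|D_gt0] := leP D 0.
  have eqY u v : Y u -> Y v -> u = v.
    move=> Yu Yv; apply/eqP; rewrite -subr_eq0; apply/eqP/norm2_eq0/eqP.
    by rewrite eq_le norm2_ge0 andbT (le_trans (hD u v Yu Yv)).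
  have Yz : Y (z 1%N).
    have il p : (p <= 0)%N -> i (0 + p)%N = 0%N /\ l (0 + p)%N = 0%N.
      by rewrite leqn0 => /eqP ->; rewrite (pata_i0 run) (pata_l0 run).
    by rewrite -[1%N]/((0 + 0).+1)%N (phase_average run il); exact: Yavg.
  exists 0%N; split; first by rewrite lt_max.
  split.
  - exists delta_up => // x [Yx _].
    by rewrite (eqY _ _ Yx Yz) subrr dot0r oppr_le0 ltW.
  - exists delta_low => //; apply: le_trans (ltW low0).
    exact: le_trans (residual_le_diameter F Y_convex Y_compact Yz) D_le0.
  - apply/testP => v Yv; rewrite (eqY _ _ Yv Yz) subrr dot0r.
    by rewrite /eps_seq invr_ge0 sqr_ge0.
pose d := D + RF; pose q := 1 - LPhi; pose c := d ^+ 2 / q.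
pose a := D ^+ 2 + 5 / 4 * (RF + H) ^+ 2.
pose b := (RF + H) ^+ 2 / (4 * eta).
pose theta := 2 / (1 - 2 * eta); pose T := iter_bound c a b theta.
have Dd : D <= d by rewrite /d lerDl.
have d0 : 0 < d by exact: lt_le_trans Dd.
have q0 : 0 < q by rewrite /q /LPhi subr_gt0.
have c0 : 0 < c by rewrite divr_gt0 ?exprn_gt0.
have a0 : 0 < a.
  by have := sqr_ge0 (RF + H); have := exprn_gt0 2 D_gt0; rewrite /a; lra.
have b0 : 0 <= b by rewrite divr_ge0 ?sqr_ge0 // mulr_ge0 // ltW.
have theta2 : 2 <= theta by rewrite ler_pdivlMr; nra.
have theta0 : 0 <= theta by lra.
have T_gt0 x : 0 < x -> 0 < T x.
  move=> x0; rewrite /T /iter_bound lt_max; apply/orP; left.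
  apply: exprn_gt0; apply: mulr_gt0 a0; apply: mulr_gt0 c0; exact: exprn_gt0.
have gap x tau u0 N : 1 <= x -> 1 <= tau -> (0 < N)%N -> T x <= N%:R ->
    Y u0 -> let u := weighted_avg (gamma_seq R)
      (proj_grad Y (Phi F G tau) (gamma_seq R) u0) N in
    forall v, Y v -> dot (Phi F G tau u) (u - v) <= (x ^+ 2)^-1.
  move=> x1 tau1 N0 TN Yu0; have x0 : 0 < x by lra.
  have tau0 : 0 < tau by lra.
  have [h1 h2] := iter_boundP (ltW c0) (ltW a0) b0 eta_range x0 N0 TN.
  have scale r : x ^+ 4 * c * r <= Num.sqrt N%:R ->
      d ^+ 2 * r <= (x ^+ 2)^-1 ^+ 2 * q * Num.sqrt N%:R.
    have e0 : 0 <= (x ^+ 2)^-1 ^+ 2 * q by rewrite mulr_ge0 ?sqr_ge0 // ltW.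
    move=> /(ler_wpM2l e0); apply: le_trans; rewrite le_eqVlt; apply/orP; left.
    by apply/eqP; rewrite /c; field; rewrite !gt_eqF.
  apply: (@phase_gap R n Y (Phi F G tau) LPhi D (RF + H) d _ eta) => //.
  - exact: Phi_monotone.
  - exact: Phi_lipschitz.
  - by move=> u Yu; exact: (Phi_norm2_le (LF := LF) (LG := LG)).
  - by rewrite invr_gt0 exprn_gt0.
  - exact: scale.
  - by rewrite -mulrA; apply: scale; rewrite mulrA.
have [m Im] : exists m : nat, Imax = m.+2%:Z.
  have : 1 < Imax.
    rewrite ltNge ceil_le_int -ltNge lt_max; apply/orP; left.
    by rewrite ltr_pdivlMr // mul1r.
  by case: Imax @I @sigma => [[|[|m]]|p] // _ _ _; exists m.
have IE : I = m.+2%:R by rewrite /I Im.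
have I2 : 2 <= I by rewrite IE ler_nat.
have I0 : 0 < I by lra.
have [I_up I_low] : 1 / delta_up <= I /\ (H + 1) / delta_low <= I.
  by apply/andP; rewrite -ge_max; exact: ceil_ge.
have sigmaE : sigma = Imax * Num.ceil (T I).
  rewrite /T /c -iter_boundE ?(ltW I0) ?(ltW d0) //.
  have -> : 4 * theta = 8 / (1 - 2 * eta) by rewrite /theta; field; lra.
  by have -> : 2 * theta = 4 / (1 - 2 * eta) by rewrite /theta; field; lra.
pose S := `|Num.ceil (T I)|%N.
have SE : Num.ceil (T I) = S%:Z.
  by rewrite /S gez0_abs // ceil_ge0; have := T_gt0 _ I0; lra.
have TS : T I <= S%:R by have := ceil_ge (T I); rewrite SE.
have S0 : (0 < S)%N.
  by rewrite lt0n; apply/eqP => S_eq0; move: TS; rewrite S_eq0 leNgt T_gt0.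
have in_time k : (k < m.+2 * S)%N -> k%:Z < Num.max 1 sigma.
  by move=> kS; rewrite sigmaE Im SE -PoszM lt_max; apply/orP; right.
have T_mono x y' : 0 <= x <= y' -> T x <= T y'.
  exact: iter_bound_mono (ltW c0) (ltW a0) b0 theta0.
pose len p := phase_len (T (tau_seq R p)).
have tau_gt0 p : 0 < tau_seq R p := lt_le_trans ltr01 (tau_seq_ge1 R p).
have len_gt0 p : (0 < len p)%N by rewrite leq_maxl.
have len_test p k : pata_test F G Y (eps_seq R p) (tau_seq R p)
    (weighted_avg (gamma_seq R)
      (proj_grad Y (Phi F G (tau_seq R p)) (gamma_seq R) (y k)) (len p)).
  by apply/testP; apply: gap; rewrite ?tau_seq_ge1 // phase_lenP.
have len_le p : (p <= m.+2)%N -> (len p <= S)%N.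
  move=> pm; apply: phase_len_le => //; first by rewrite ltW ?T_gt0.
  apply: le_trans TS; apply: T_mono; rewrite ltW //=.
  by rewrite ge_max IE ler1n ler_nat.
have up_ok eps tau u x : 0 < tau -> Y u ->
    (forall v, Y v -> dot (Phi F G tau u) (u - v) <= eps) ->
    tau * eps <= delta_up -> SOL F Y x -> - delta_up <= dot (G u) (x - u).
  move=> tau0 Yu gapu small solx.
  by apply: le_trans (upper_gap tau0 F_monotone Yu gapu solx); rewrite lerN2.
have I_inv : I^-1 <= delta_up.
  by rewrite -[leRHS]invrK lef_pV2 ?posrE ?invr_gt0 // -div1r.
have low_ok : (H + 1) / I <= delta_low.
  by rewrite ler_pdivrMr // mulrC -ler_pdivrMr.
have [S1|S1] := leqP S 1.
  (* All phases last one iteration: there is only time for I phases, and the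
     gap of the last one is better than its test requires. *)
  have {}S1 : S = 1%N by apply/eqP; rewrite eqn_leq S1 S0.
  have [k0 [k0le ik0 lk0]] : exists k0,
      [/\ (k0 <= \sum_(p < m.+1) len p)%N, i k0 = m.+1 & l k0 = k0].
    by apply: (phase_reached run) => p k _; split.
  have {}k0le : (k0 <= m.+1)%N.
    apply: leq_trans k0le _; rewrite -[leqRHS]card_ord -sum1_card.
    by apply: leq_sum => p _; rewrite -S1 len_le // ltnW // ltnS ltnW.
  have [p [p1 ip zp testp]] := phase_ends run ik0 lk0 (len_gt0 _) (len_test _ k0).
  have p0 : p = 0%N.
    apply/eqP; rewrite -leqn0 -ltnS (leq_trans p1) // -S1; exact: len_le.
  rewrite p0 addn0 in ip zp testp.
  have Yz : Y (z k0.+1) by rewrite zp; exact: Yavg.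
  exists k0; split; first by apply: in_time; rewrite S1 muln1 ltnS.
  split; last by rewrite ip.
  - exists delta_up => // x; apply: (up_ok (I ^+ 2)^-1 (tau_seq R m.+1)) => //.
      by rewrite zp; apply: gap; rewrite ?tau_seq_ge1 -?S1 //; lra.
    apply: le_trans I_inv; rewrite ler_pdivrMr ?exprn_gt0 //.
    rewrite expr2 mulrA mulVf ?gt_eqF // mul1r tau_seqS IE ler_nat //.
  exists ((H + 1) / I) => //.
  apply: le_trans (residual_le_diameter F Y_convex Y_compact Yz) _.
  rewrite -/D ler_pdivlMr //.
  suff : D * I <= 1 by lra.
  (* Both c and a are at least D ^+ 2. *)
  have Ica : I ^+ 4 * c * a <= 1.
    apply: le_from_sqr => //.
    by rewrite expr1n; move: TS; rewrite S1 ge_max => /andP[].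
  have D_a : D ^+ 2 <= a by rewrite lerDl; have := sqr_ge0 (RF + H); lra.
  have D_c : D ^+ 2 <= c.
    rewrite ler_pdivlMr //; apply: (@le_trans _ _ (D ^+ 2)).
      by rewrite ler_piMr ?sqr_ge0 // /q /LPhi; lra.
    by rewrite ler_pXn2r ?nnegrE // ltW.
  rewrite -(@ler_pXn2r _ 4) ?nnegrE ?mulr_ge0 ?(ltW I0) // expr1n.
  have -> : (D * I) ^+ 4 = I ^+ 4 * (D ^+ 2 * D ^+ 2) by ring.
  apply: le_trans Ica; rewrite -[leRHS]mulrA.
  apply: ler_wpM2l; first exact: exprn_ge0 (ltW I0).
  by apply: ler_pM; rewrite ?sqr_ge0.
have [k0 [k0le ik0 lk0]] : exists k0,
    [/\ (k0 <= \sum_(p < m.+2) len p)%N, i k0 = m.+2 & l k0 = k0].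
  by apply: (phase_reached run) => p k _; split.
(* Phases 0 and 1 together take at most S iterations, as does each later one. *)
have {}k0le : (k0 <= m.+1 * S)%N.
  apply: leq_trans k0le _; rewrite 2!big_ord_recl addnA mulSn.
  apply: leq_add.
    rewrite /len /= tau_seq0 tau_seqS; apply: phase_len_twice TS S1.
      by rewrite ltW ?T_gt0.
    exact: iter_bound_growth (ltW c0) (ltW a0) b0 theta2 I2.
  rewrite -[leqRHS]/(m * S)%N -[X in (X * S)%N]card_ord -sum_nat_const.
  by apply: leq_sum => p _; apply: len_le; exact/ltnW/ltn_ord.
have [p [pS ip zp testp]] := phase_ends run ik0 lk0 (len_gt0 _) (len_test _ k0).
have Yz : Y (z (k0 + p).+1) by rewrite zp; exact: Yavg.
exists (k0 + p)%N; split.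
  apply: in_time; rewrite mulSn addnC -addSn; apply: leq_add => //.
  exact: leq_trans pS (len_le _ _).
have gapz := (testP _ _ _).1 testp.
rewrite ip; split=> //.
- exists delta_up => // x; apply: (up_ok _ _ _ _ (tau_gt0 m.+2) Yz gapz).
  rewrite /eps_seq tau_seqS -IE expr2 invfM mulrA divff ?gt_eqF // mul1r.
  exact: I_inv.
- exists ((H + 1) / I) => //; rewrite IE -tau_seqS.
  exact: lower_residual Y_convex Y_compact G_lipschitz (tau_gt0 _) Yz gapz.
Qed.
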